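(* Let $(Z,d)$ be a pseudometric space, $X\cup Y=Z$ a cover, $A:=X\cap Y$, and $r\in[0,\infty)$. Assume $A$ is finite, $(Z,d)$ is a metric gluing of $X$ and $Y$, and the strong simplex assumption holds for $r$. Let $P:=\{\sigma\in \mathrm{VR}_r(Z)\mid \sigma\subset X\text{ or }\sigma\subset Y\text{ or }\sigma\cap A\ne\emptyset\}$. Then for every simplex $\sigma\in\mathrm{VR}_r(Z)\setminus P$ such that either $|\sigma\cap X|=1$ or $|\sigma\cap Y|=1$, the obstruction complex $\mathrm{St}(\sigma,A)$ is contractible. Moreover, the homotopy fibers of the inclusion $\mathrm{VR}_r(X)\cup\mathrm{VR}_r(Y)\hookrightarrow\mathrm{VR}_r(Z)$ are simply connected, and this map induces an isomorphism on $\pi_0$ and $\pi_1$ and a surjection on $\pi_2$.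
   Context: A pseudometric on $Z$ is a function $d\colon Z\times Z\to[0,\infty]$ that is symmetric, satisfies $d(x,x)=0$, and satisfies the triangle inequality. For $r\in[0,\infty)$, the Vietoris–Rips complex $\mathrm{VR}_r(Z)$ is the simplicial complex of all finite nonempty $\sigma\subset Z$ with $d(x,y)\le r$ for all $x,y\in\sigma$; for $B\subset Z$, $\mathrm{VR}_r(B)$ is defined using the restricted distance. $(Z,d)$ is a metric gluing (of $X$ and $Y$ along $A$) if for all $x\in X\setminus A$ and $y\in Y\setminus A$ one has $d(x,y)=\inf\{d(x,a)+d(a,y)\mid a\in A\}$. The strong simplex assumption for $r$: for every vertex $v$ of an edge (1-dimensional simplex) $\sigma$ of $\mathrm{VR}_r(Z)\setminus P$, and all $a,b\in A$ with $d(a,v)\le r$ and $d(v,b)\le r$, one has $2d(a,b)\le d(a,v)+d(v,b)$. For a simplex $\sigma$ of $K=\mathrm{VR}_r(Z)$, $\mathrm{St}(\sigma,A):=\{\mu\subset A\mid 0<|\mu|<\infty,\ \mu\cup\sigma\in K\}$. Homotopical notions refer to geometric realizations. *)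

(* Defs.v *)
From HB Require Import structures.
From mathcomp Require Import all_boot all_order all_algebra.
From mathcomp Require Import all_classical all_reals topology ereal normedtype.
Set Implicit Arguments. Unset Strict Implicit. Unset Printing Implicit Defensive.
Import Order.TTheory GRing.Theory Num.Theory numFieldNormedType.Exports.
Local Open Scope classical_set_scope.
Local Open Scope ring_scope.

Definition pseudometric (R : realType) (Z : Type) (d : Z -> Z -> \bar R) : Prop :=
  [/\ forall x y, (0 <= d x y)%E,
      forall x, d x x = 0%E,
      forall x y, d x y = d y x &
      forall x y z, (d x z <= d x y + d y z)%E].

(* simplicial complexes are represented as sets of (finite nonempty) subsets *)
(* of the vertex type Z *)

Definition VR (R : realType) (Z : Type) (d : Z -> Z -> \bar R) (r : R) (B : set Z)
  : set (set Z) :=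
  [set s | [/\ finite_set s, s !=set0, s `<=` B &
              forall x y, s x -> s y -> (d x y <= r%:E)%E]].

Definition metric_gluing (R : realType) (Z : Type) (d : Z -> Z -> \bar R)
  (X Y : set Z) : Prop :=
  forall x y, X x -> ~ (X `&` Y) x -> Y y -> ~ (X `&` Y) y ->
    d x y = ereal_inf [set (d x a + d a y)%E | a in X `&` Y].

Definition Pgood (R : realType) (Z : Type) (d : Z -> Z -> \bar R) (r : R)
  (X Y : set Z) : set (set Z) :=
  [set s | VR d r setT s /\ [\/ s `<=` X, s `<=` Y | s `&` (X `&` Y) !=set0]].

Definition is_edge (Z : Type) (s : set Z) : Prop :=
  exists x y, x <> y /\ s = [set x; y].

Definition strong_simplex_assumption (R : realType) (Z : Type)
  (d : Z -> Z -> \bar R) (r : R) (X Y : set Z) : Prop :=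
  forall s, VR d r setT s -> ~ Pgood d r X Y s -> is_edge s ->
  forall v, s v -> forall a b, (X `&` Y) a -> (X `&` Y) b ->
    (d a v <= r%:E)%E -> (d v b <= r%:E)%E ->
    (2%:E * d a b <= d a v + d v b)%E.

Definition St (Z : Type) (K : set (set Z)) (s A : set Z) : set (set Z) :=
  [set mu | [/\ mu `<=` A, mu !=set0, finite_set mu & K (mu `|` s)]].

Definition supp (R : realType) (Z : choiceType) (t : Z -> R) : set Z :=
  [set v | t v != 0].

Definition real_pt (R : realType) (Z : choiceType) (K : set (set Z))
  (t : Z -> R) : Prop :=
  [/\ forall v, 0 <= t v, K (supp t) & \sum_(v \in supp t) t v = 1].

Definition geom (R : realType) (Z : choiceType) (K : set (set Z)) : Type :=
  {t : Z -> R | real_pt K t}.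


HB.instance Definition _ (R : realType) (Z : choiceType) (K : set (set Z)) :=
  gen_eqMixin (geom R K).
HB.instance Definition _ (R : realType) (Z : choiceType) (K : set (set Z)) :=
  gen_choiceMixin (geom R K).

(* coherent (weak) topology: U is open iff its trace on every closed simplex *)
(* |s| = { t | supp t `<=` s }, s in K, is open for the euclidean topology   *)
(* of |s| (here given by the sup-distance on the finitely many coordinates). *)
Definition geom_open (R : realType) (Z : choiceType) (K : set (set Z))
  (U : set (geom R K)) : Prop :=
  forall s, K s -> forall t : geom R K, U t -> supp (sval t) `<=` s ->
  exists2 e : R, 0 < e & forall t' : geom R K, supp (sval t') `<=` s ->
     (forall v, `|sval t v - sval t' v| < e) -> U t'.

Lemma geom_openT (R : realType) (Z : choiceType) (K : set (set Z)) :
  geom_open (@setT (geom R K)).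
Proof. by move=> s _ t _ _; exists 1 => //. Qed.

Lemma geom_openI (R : realType) (Z : choiceType) (K : set (set Z)) :
  setI_closed (@geom_open R Z K).
Proof.
move=> U V oU oV s Ks t [Ut Vt] st.
have [e1 e10 H1] := oU s Ks t Ut st.
have [e2 e20 H2] := oV s Ks t Vt st.
exists (Num.min e1 e2); first by rewrite lt_min e10 e20.
move=> t' st' ht'; split.
- by apply: H1 => // v; apply: lt_le_trans (ht' v) _; rewrite ge_min lexx.
- by apply: H2 => // v; apply: lt_le_trans (ht' v) _; rewrite ge_min lexx orbT.
Qed.

Lemma geom_open_bigU (R : realType) (Z : choiceType) (K : set (set Z))
  (I : Type) (f : I -> set (geom R K)) :
  (forall i, geom_open (f i)) -> geom_open (\bigcup_i f i).
Proof.
move=> hf s Ks t [i _ fit] st.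
have [e e0 H] := hf i s Ks t fit st.
by exists e => // t' st' ht'; exists i => //; apply: H.
Qed.

HB.instance Definition _ (R : realType) (Z : choiceType) (K : set (set Z)) :=
  isOpenTopological.Build (geom R K)
    (@geom_openT R Z K) (@geom_openI R Z K) (@geom_open_bigU R Z K).

Definition geom_incl (R : realType) (Z : choiceType) (K L : set (set Z))
  (KL : K `<=` L) (t : geom R K) : geom R L :=
  let: exist f (And3 f0 fK f1) := t in exist _ f (And3 f0 (KL _ fK) f1).

Lemma VR_union_sub (R : realType) (Z : Type) (d : Z -> Z -> \bar R) (r : R)
  (X Y : set Z) : VR d r X `|` VR d r Y `<=` VR d r setT.
Proof. by move=> s [] [fs s0 _ hs]; split. Qed.

Definition unitI (R : realType) : set R := `[0, 1].
Arguments unitI R : clear implicits.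
Definition unitI2 (R : realType) : set (R * R) :=
  [set p | unitI R p.1 /\ unitI R p.2].
Arguments unitI2 R : clear implicits.
Definition unitI3 (R : realType) : set (R * (R * R)) :=
  [set p | unitI R p.1 /\ unitI2 R p.2].
Arguments unitI3 R : clear implicits.

Definition contractible (R : realType) (T : topologicalType) : Prop :=
  inhabited T /\
  exists (c : T) (H : R * T -> T),
    [/\ {within [set p : R * T | unitI R p.1], continuous H},
        forall x, H (0, x) = x &
        forall x, H (1, x) = c].

Definition is_path (R : realType) (T : topologicalType) (g : R -> T) (x y : T) :=
  [/\ {within unitI R, continuous g}, g 0 = x & g 1 = y].

Definition path_connected_pts (R : realType) (T : topologicalType) (x y : T) :=
  exists g : R -> T, is_path g x y.

Definition loop_at (R : realType) (T : topologicalType) (x : T) (g : R -> T) :=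
  is_path g x x.

Definition loop_homotopic (R : realType) (T : topologicalType) (x : T)
  (g g' : R -> T) : Prop :=
  exists H : R * R -> T,
    [/\ {within unitI2 R, continuous H},
        forall s, unitI R s -> H (0, s) = g s,
        forall s, unitI R s -> H (1, s) = g' s &
        forall u, unitI R u -> H (u, 0) = x /\ H (u, 1) = x].

Definition boundaryI2 (R : realType) : set (R * R) :=
  [set p | unitI2 R p /\ (p.1 = 0 \/ p.1 = 1 \/ p.2 = 0 \/ p.2 = 1)].

Arguments boundaryI2 R : clear implicits.

Definition sphere_at (R : realType) (T : topologicalType) (x : T)
  (g : R * R -> T) : Prop :=
  {within unitI2 R, continuous g} /\ forall p, boundaryI2 R p -> g p = x.

Definition sphere_homotopic (R : realType) (T : topologicalType) (x : T)
  (g g' : R * R -> T) : Prop :=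
  exists H : R * (R * R) -> T,
    [/\ {within unitI3 R, continuous H},
        forall p, unitI2 R p -> H (0, p) = g p,
        forall p, unitI2 R p -> H (1, p) = g' p &
        forall u p, unitI R u -> boundaryI2 R p -> H (u, p) = x].

Definition pi0_bijective (T U : topologicalType) (R : realType) (f : T -> U) :=
  (forall y : U, exists x : T, path_connected_pts R (f x) y) /\
  (forall x x' : T, path_connected_pts R (f x) (f x') -> path_connected_pts R x x').

Definition pi1_iso (T U : topologicalType) (R : realType) (f : T -> U) :=
  forall x : T,
  (forall g : R -> U, loop_at (f x) g ->
     exists2 h : R -> T, loop_at x h & loop_homotopic (f x) g (f \o h)) /\
  (forall h h' : R -> T, loop_at x h -> loop_at x h' ->
     loop_homotopic (f x) (f \o h) (f \o h') -> loop_homotopic x h h').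

Definition pi2_surj (T U : topologicalType) (R : realType) (f : T -> U) :=
  forall x : T, forall g : R * R -> U, sphere_at (f x) g ->
    exists2 h : R * R -> T, sphere_at x h & sphere_homotopic (f x) g (f \o h).

(* Homotopy fiber of f over y: F_y = { (x, c) | c path in U from f x to y }, *)
(* with the subspace topology of T x U^I (compact-open topology).  By the    *)
(* exponential law (I is compact Hausdorff), a continuous map K -> F_y is    *)
(* the same as a pair (a : K -> T, G : K x I -> U) of continuous maps with   *)
(* G (k,0) = f (a k) and G (k,1) = y.  We use this description for K = a   *)
(* point, K = I (paths) and K = I x I (homotopies of loops).                  *)
Definition hofiber_pt (T U : topologicalType) (R : realType) (f : T -> U) (y : U)
  (x : T) (c : R -> U) : Prop := is_path c (f x) y.

Definition hofiber_path (T U : topologicalType) (R : realType) (f : T -> U) (y : U)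
  (x0 : T) (c0 : R -> U) (x1 : T) (c1 : R -> U)
  (a : R -> T) (G : R * R -> U) : Prop :=
  [/\ is_path a x0 x1, {within unitI2 R, continuous G},
      (forall s, unitI R s -> G (0, s) = c0 s /\ G (1, s) = c1 s) &
      (forall t, unitI R t -> G (t, 0) = f (a t) /\ G (t, 1) = y)].

Definition hofiber_simply_connected (T U : topologicalType) (R : realType)
  (f : T -> U) (y : U) : Prop :=
  (exists (x : T) (c : R -> U), hofiber_pt f y x c) /\
  (forall x0 (c0 : R -> U) x1 (c1 : R -> U), hofiber_pt f y x0 c0 -> hofiber_pt f y x1 c1 ->
     exists a G, hofiber_path f y x0 c0 x1 c1 a G) /\
  (forall x0 c0 a G, hofiber_pt f y x0 c0 -> hofiber_path f y x0 c0 x0 c0 a G ->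
     exists (A : R * R -> T) (B : R * (R * R) -> U),
       [/\ {within unitI2 R, continuous A}, {within unitI3 R, continuous B},
           (forall t, unitI R t -> A (0, t) = a t /\ A (1, t) = x0) &
           (forall u, unitI R u -> A (u, 0) = x0 /\ A (u, 1) = x0)] /\
       [/\ (forall t s, unitI R t -> unitI R s ->
              B (0, (t, s)) = G (t, s) /\ B (1, (t, s)) = c0 s),
           (forall u s, unitI R u -> unitI R s ->
              B (u, (0, s)) = c0 s /\ B (u, (1, s)) = c0 s) &
           (forall u t, unitI R u -> unitI R t ->
              B (u, (t, 0)) = f (A (u, t)) /\ B (u, (t, 1)) = y)]).

(* Main.v *)
(* Write K = VR(X) u VR(Y) and L = VR(Z).  All conclusions about the map of
   realizations follow from one fact: every map g from the square to |L| is
   homotopic to a map into |K| by a homotopy that keeps the points of g^-1(|K|)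
   in |K|.  Such a homotopy, used on a core of the square and slowed down on a
   collar, becomes relative to the boundary.

   To construct it, approximate g by a simplicial map.  A bad simplex with at
   most three vertices has a single vertex on one side, and then, by the gluing
   and strong simplex assumptions, some point of A is within r of all its
   vertices.  Choose such a point as the center of each bad simplex, and a vertex
   (in A if possible) as the center of each good one.  Mapping the barycentric
   subdivision to the centers lands in |K|: points of A near a bad edge are
   pairwise within r, and the centers of a flag cannot meet both X \ A and
   Y \ A.  The same two facts show that St(s, A) is a full simplex. *)

(* The bound of three vertices fixes the range of degrees. A bad simplex with two vertices on each
   side may have no point of A near all of its vertices, so only maps of the square are pushed; this
   suffices for injectivity on loops and for null-homotopies of loops in the fibers, and in degree 2
   it gives surjectivity only.

   The approximation cannot be moved to the centers in one linear step, because the center of an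
   edge need not be within r of the third vertex of a triangle. Triangles are therefore coned off
   before edges.

   The relative statements all come from one box over the square: its floor lies in |K|, its walls
   are the collar of a given map F, and its ceiling is the core of F. Each conclusion amounts to a
   choice of F. For homotopy fibers the collar carries the paths in |L| and the core is the constant
   y.

   In the weak topology a function with continuous coordinates need not be continuous. Every
   construction therefore keeps its supports in one finite vertex set, which compactness of the
   square provides. *)
Require Import Defs.
From HB Require Import structures.
From mathcomp Require Import all_boot all_order all_algebra.
From mathcomp Require Import all_classical all_reals topology ereal normedtype.
From mathcomp Require Import finmap ring lra zify.
Set Implicit Arguments. Unset Strict Implicit. Unset Printing Implicit Defensive.
Import Order.TTheory GRing.Theory Num.Theory numFieldNormedType.Exports.
Local Open Scope classical_set_scope.
Local Open Scope ring_scope.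

(** * Continuity of explicit functions *)

Section RealContinuity.
Variables (R : realType) (T : topologicalType).
Implicit Types f g : T -> R.

Lemma contD f g : continuous f -> continuous g -> continuous (fun x => f x + g x).
Proof. by move=> cf cg x; apply: cvgD; [exact: cf|exact: cg]. Qed.

Lemma contB f g : continuous f -> continuous g -> continuous (fun x => f x - g x).
Proof. by move=> cf cg x; apply: cvgB; [exact: cf|exact: cg]. Qed.

Lemma contN f : continuous f -> continuous (fun x => - f x).
Proof. by move=> cf x; apply: cvgN; exact: cf. Qed.

Lemma contM f g : continuous f -> continuous g -> continuous (fun x => f x * g x).
Proof. by move=> cf cg x; apply: cvgM; [exact: cf|exact: cg]. Qed.

Lemma contV f : continuous f -> (forall x, f x != 0) ->
  continuous (fun x => (f x)^-1).
Proof. by move=> cf f0 x; apply: cvgV; [exact: f0|exact: cf]. Qed.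

Lemma cont_norm f : continuous f -> continuous (fun x => `|f x|).
Proof. by move=> cf x; apply: cvg_norm; exact: cf. Qed.

Lemma cont_max f g : continuous f -> continuous g ->
  continuous (fun x => Num.max (f x) (g x)).
Proof. by move=> cf cg x; apply: continuous_max; [exact: cf|exact: cg]. Qed.

Lemma cont_min f g : continuous f -> continuous g ->
  continuous (fun x => Num.min (f x) (g x)).
Proof. by move=> cf cg x; apply: continuous_min; [exact: cf|exact: cg]. Qed.

Lemma cont_sum (I : Type) (r : seq I) (P : pred I) (f : I -> T -> R) :
  (forall i, continuous (f i)) -> continuous (fun x => \sum_(i <- r | P i) f i x).
Proof.
move=> cf; elim: r => [|i r IH].
  by under eq_fun do rewrite big_nil; exact: cst_continuous.
under eq_fun do rewrite big_cons; case: (P i) => //.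
exact: contD.
Qed.

Lemma cont_prod (I : Type) (r : seq I) (P : pred I) (f : I -> T -> R) :
  (forall i, continuous (f i)) -> continuous (fun x => \prod_(i <- r | P i) f i x).
Proof.
move=> cf; elim: r => [|i r IH].
  by under eq_fun do rewrite big_nil; exact: cst_continuous.
under eq_fun do rewrite big_cons; case: (P i) => //.
exact: contM.
Qed.

Lemma cont_comp (U : topologicalType) (V : topologicalType) (f : T -> U) (g : U -> V) :
  continuous f -> continuous g -> continuous (fun x => g (f x)).
Proof. by move=> cf cg x; apply: continuous_comp; [exact: cf|exact: cg]. Qed.

Lemma cont_pair (U V : topologicalType) (f : T -> U) (g : T -> V) :
  continuous f -> continuous g -> continuous (fun x => (f x, g x)).
Proof. by move=> cf cg x; apply: cvg_pair; [exact: cf|exact: cg]. Qed.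

Lemma cont_fst (U V : topologicalType) (f : T -> U * V) :
  continuous f -> continuous (fun x => (f x).1).
Proof. by move=> cf x; apply: cvg_comp; [exact: cf|exact: cvg_fst]. Qed.

Lemma cont_snd (U V : topologicalType) (f : T -> U * V) :
  continuous f -> continuous (fun x => (f x).2).
Proof. by move=> cf x; apply: cvg_comp; [exact: cf|exact: cvg_snd]. Qed.

(** Pasting along the zero set of [b]: there both branches have the same value, so a neighbourhood
    of it pulls back along both of them. *)
Lemma cont_if (U : topologicalType) (b : T -> R) (f g : T -> U) :
  continuous b -> continuous f -> continuous g ->
  (forall x, b x = 0 -> f x = g x) ->
  continuous (fun x => if b x <= 0 then f x else g x).
Proof.
move=> cb cf cg fg x.
have [bx|bx|bx] := ltgtP (b x) 0.
- have E : {near x, f =1 (fun x => if b x <= 0 then f x else g x)}.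
    have : nbhs (b x) [set y : R | y < 0].
      by apply: open_nbhs_nbhs; split => //; exact: open_lt.
    by move/(cb x); apply: (@filterS _ (nbhs x)) => y /= /ltW ->.
  rewrite /continuous_at (ltW bx).
  by apply: cvg_trans (cf x); apply: near_eq_cvg.
- have E : {near x, g =1 (fun x => if b x <= 0 then f x else g x)}.
    have : nbhs (b x) [set y : R | 0 < y].
      by apply: open_nbhs_nbhs; split => //; exact: open_gt.
    by move/(cb x); apply: (@filterS _ (nbhs x)) => y /= by0; rewrite leNgt by0.
  rewrite /continuous_at leNgt bx /=.
  by apply: cvg_trans (cg x); apply: near_eq_cvg.
- rewrite /continuous_at bx lexx => A nA.
  have := cf x A nA; have := cg x A; rewrite -(fg _ bx) => /(_ nA).
  apply: (@filterS2 _ (nbhs x)) => y /= Ag Af.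
  by case: ifP.
Qed.

End RealContinuity.

Ltac cont := repeat first
  [ exact: cst_continuous | by move=> ?; exact: cvg_id | assumption
  | apply: contD | apply: contB | apply: contN | apply: contM | apply: cont_norm
  | apply: cont_max | apply: cont_min | apply: cont_fst | apply: cont_snd
  | apply: cont_pair ].

(** * The weak topology on geometric realizations *)

Lemma geom_eq (R : realType) (Z : choiceType) (K : set (set Z))
  (t t' : geom R K) : (forall v, sval t v = sval t' v) -> t = t'.
Proof.
case: t t' => [t tP] [t' t'P] /= /funext E; subst t'.
by congr exist; exact: Prop_irrelevance.
Qed.

Lemma geom_inclE (R : realType) (Z : choiceType) (K L : set (set Z))
  (KL : K `<=` L) (t : geom R K) : sval (geom_incl KL t) = sval t.
Proof. by case: t => t []. Qed.

Lemma geom_supp (R : realType) (Z : choiceType) (K : set (set Z))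
  (t : geom R K) : K (supp (sval t)).
Proof. by case: t => t []. Qed.

Lemma geom_ge0 (R : realType) (Z : choiceType) (K : set (set Z))
  (t : geom R K) v : 0 <= sval t v.
Proof. by case: t => t []. Qed.

Lemma open_geomE (R : realType) (Z : choiceType) (K : set (set Z))
  (U : set (geom R K)) : open U = geom_open U.
Proof. by []. Qed.

Lemma continuous_coord (R : realType) (Z : choiceType) (K : set (set Z)) (v : Z) :
  continuous (fun t : geom R K => sval t v).
Proof.
apply/continuousP => U oU; rewrite open_geomE => s Ks t Ut _ /=.
have /nbhs_ballP[e e0 eU] : nbhs (sval t v) U by apply: open_nbhs_nbhs.
by exists e => // t' _ /(_ v) tt'; apply: eU.
Qed.

Lemma near_bigfset (T : topologicalType) (I : choiceType) (D : {fset I}) (p : T)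
  (P : I -> T -> Prop) :
  (forall i, i \in D -> \forall q \near p, P i q) ->
  \forall q \near p, forall i, i \in D -> P i q.
Proof.
move=> H.
have := @filter_bigI T I D P (nbhs p) (nbhs_filter p) H.
by apply: filterS => q /= Hq i iD; exact: Hq.
Qed.

(* In the weak topology, continuity is coordinatewise only because all the
   supports lie in one finite set, which has finitely many faces. *)
Lemma geom_continuous (R : realType) (Z : choiceType) (K : set (set Z))
  (T : topologicalType) (F : {fset Z}) (f : T -> geom R K) :
  (forall v, continuous (fun p => sval (f p) v)) ->
  (forall p v, v \notin F -> sval (f p) v = 0) -> continuous f.
Proof.
move=> fc fF; apply/continuousP => U; rewrite open_geomE => oU; rewrite openE => p /= Up.
pose S q := [fset v in F | sval (f q) v != 0]%fset.
have SE q : supp (sval (f q)) = [set` S q].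
  apply/seteqP; split => v; rewrite /supp /= !inE /=; last by case/andP.
  by move=> v0; rewrite v0 andbT; apply: contraNT v0 => vF; rewrite fF.
(* Finitely many sets [s] can be the support of [f q], so one neighbourhood for each suffices. If
   [s] misses a vertex of the support at [p], then nearby [q] do not have support [s]; otherwise
   openness inside the closed simplex [s] applies. *)
have : \forall q \near p, forall s, s \in fpowerset F -> S q = s -> U (f q).
  apply: near_bigfset => s sF.
  have [Sps|] := boolP (S p `<=` s)%fset; last first.
    case/fsubsetPn => v; rewrite /S !inE => /andP[vF fpv] vs.
    have : \forall q \near p, sval (f q) v != 0.
      have : nbhs (sval (f p) v) [set x : R | x != 0].
        by apply: open_nbhs_nbhs; split => //; exact: open_neq.
      by move=> /(fc v p).
    apply: filterS => q fqv Sq; move: vs; rewrite -Sq /S !inE fqv andbT vF.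
    by [].
  have [Ks|nKs] := pselect (K [set` s]); last first.
    near=> q => Sq; case: nKs; rewrite -Sq -SE; exact: geom_supp.
  have [|e e0 eU] := oU _ Ks (f p) Up.
    by rewrite SE => v /= /(fsubsetP Sps).
  have : \forall q \near p, forall v, v \in F -> `|sval (f p) v - sval (f q) v| < e.
    apply: near_bigfset => v vF.
    by have /cvgrPdist_lt/(_ e e0) := fc v p.
  apply: filterS => q Hq Sq; apply: eU; first by rewrite SE Sq.
  move=> v; case: (boolP (v \in F)) => vF; first exact: Hq.
  by rewrite !fF // subrr normr0.
apply: filterS => q Hq; apply: (Hq (S q)) => //.
by rewrite fpowersetE; apply/fsubsetP => v; rewrite !inE => /andP[].
Unshelve. all: by end_near. Qed.

(** Normalization is done once here, so the homotopies below can be written with unnormalized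
    nonnegative weights. *)
Lemma conic_map (R : realType) (Z : choiceType) (K : set (set Z))
  (T : topologicalType) (F : {fset Z}) (n : T -> Z -> R) :
  (forall s, K s -> s !=set0) ->
  (forall p v, 0 <= n p v) ->
  (forall v, continuous (fun p => n p v)) ->
  (forall p v, v \notin F -> n p v = 0) ->
  (forall p, K (supp (n p))) ->
  exists2 f : T -> geom R K, continuous f &
    forall p v, sval (f p) v = n p v / \sum_(w <- F) n p w.
Proof.
move=> K0 n0 nc nF nK.
have S0 p : 0 < \sum_(w <- F) n p w.
  have [v /= nv] := K0 _ (nK p).
  have vF : v \in F by apply: contraNT nv => /nF ->.
  rewrite (big_fsetD1 v) //= ltr_wpDr ?sumr_ge0 //.
  by rewrite lt_neqAle eq_sym nv n0.
have suppE p : supp (fun v => n p v / \sum_(w <- F) n p w) = supp (n p).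
  apply/seteqP; split => v; rewrite /supp /= mulf_eq0 invr_eq0 negb_or.
    by case/andP.
  by move=> ->; rewrite gt_eqF.
have nP p : real_pt K (fun v => n p v / \sum_(w <- F) n p w).
  split; first by move=> v; rewrite divr_ge0 // ltW.
    by rewrite suppE.
  rewrite suppE (fsbig_fwiden F) //=.
  - by rewrite -mulr_suml divff // gt_eqF.
  - by move=> v /=; apply: contraNT => /nF ->.
  - by move=> v [/= vF] /negP; rewrite negbK => /eqP ->; rewrite mul0r.
exists (fun p => exist _ _ (nP p)) => //.
apply: (@geom_continuous _ _ _ _ F) => [v p|p v vF] /=; last by rewrite nF // mul0r.
apply: cvgM; first exact: nc.
apply: cvgV; first by rewrite gt_eqF.
by apply: (@cont_sum _ _ _ F xpredT (fun w p => n p w)) => w; exact: nc.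
Qed.

Lemma closed_geom1 (R : realType) (Z : choiceType) (K : set (set Z))
  (t : geom R K) : closed [set t].
Proof.
have -> : [set t] = \bigcap_v [set t' : geom R K | sval t' v = sval t v].
  by apply/seteqP; split => [_ -> //|t' H]; apply: geom_eq => v; exact: H.
apply: closed_bigI => v _.
have /continuous_closedP cl := @continuous_coord R Z K v.
exact: (cl _ (@closed_eq _ (sval t v))).
Qed.

(* Picking for each vertex v of the image a point whose v-coordinate is nonzero
   gives a closed discrete set, because every simplex holds finitely many of
   these points.  Such a set is finite in a compact space. *)
Lemma compact_support (R : realType) (Z : choiceType) (K : set (set Z))
  (T : topologicalType) (x0 : T) (g : T -> geom R K) (A : set T) :
  (forall s, K s -> finite_set s /\ s !=set0) -> continuous g -> compact A ->
  exists F : {fset Z}, forall p v, A p -> v \notin F -> sval (g p) v = 0.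
Proof.
pose pT : ptopologicalType := HB.pack T (isPointed.Build T x0).
move=> fK gc cA0; have cA : cover_compact A.
  by have := @compact_cover pT; rewrite predeqE => /(_ A)[+ _]; apply.
pose V := [set v | exists2 p, A p & sval (g p) v != 0].
have /choice[q qP] : forall v : Z, exists p, V v -> A p /\ sval (g p) v != 0.
  by move=> v; have [[p Ap pv]|] := pselect (V v); [exists p|exists x0].
pose W v : set (geom R K) :=
  [set t | forall w, V w -> g (q w) <> g (q v) -> t <> g (q w)].
have oW v : open (W v).
  rewrite open_geomE => s Ks t Wt ts.
  pose C := \bigcup_(w in s `&` [set w | V w /\ g (q w) <> g (q v)])
              [set g (q w)].
  have oC : geom_open (~` C).
    rewrite -open_geomE; apply: closed_openC; apply: closed_bigcup.
      by apply: finite_setIl; case: (fK _ Ks).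
    by move=> w _; exact: closed_geom1.
  have [|e e0 eC] := oC s Ks t _ ts.
    by case=> w [_ [Vw wv]] /= tw; exact: Wt tw.
  exists e => // t' st' tt' w Vw wv E; apply: (eC _ st' tt').
  exists w => //; split; last by [].
  by apply: st'; rewrite /= E; case: (qP _ Vw).
have [|p Ap|D DV AD] := cA Z V (fun v => g @^-1` W v).
- by move=> v _; have /continuousP := gc; apply.
- have [[v Vv pv]|nV] := pselect (exists2 v, V v & g p = g (q v)).
    by exists v => //= w Vw wv E; apply: wv; rewrite -E.
  have [_ [v /= pv]] := fK _ (geom_supp (g p)).
  exists v; first by exists p.
  by move=> w Vw _ E; apply: nV; exists w.
exists (\bigcup_(v <- D) fset_set (supp (sval (g (q v)))))%fset => p v Ap.
apply: contraNeq => pv.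
have Vv : V v by exists p.
(* The chosen value [g (q v)] lies in some [W w] of the finite subcover, and the only chosen value
   in [W w] is [g (q w)]; hence the two coincide. *)
have [Aq qv] := qP _ Vv.
have [w /= wD Ww] := AD _ Aq.
have E : g (q v) = g (q w).
  by apply: contrapT => /(Ww _ Vv); apply.
apply/bigfcupP; exists w; first by rewrite wD.
rewrite in_fset_set; last by case: (fK _ (geom_supp (g (q w)))).
by apply: mem_set; rewrite /supp /= -E.
Qed.

(** No comparison of the weak topology of [K] with the one induced from [L] is made: the finite set
    [F] reduces continuity into [geom R K] to coordinates. *)
Lemma geom_lift (R : realType) (Z : choiceType) (K L : set (set Z))
  (KL : K `<=` L) (T : topologicalType) (F : {fset Z}) (f : T -> geom R L) :
  continuous f -> (forall p v, v \notin F -> sval (f p) v = 0) ->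
  (forall p, K (supp (sval (f p)))) ->
  exists2 h : T -> geom R K, continuous h & forall p, geom_incl KL (h p) = f p.
Proof.
move=> fc fF fK.
have fP p : real_pt K (sval (f p)).
  by have := fK p; case: (f p) => t [t0 tL t1] /= Kt; split.
exists (fun p => exist _ _ (fP p)); last first.
  by move=> p; apply: geom_eq => v; rewrite geom_inclE.
apply: (@geom_continuous _ _ _ _ F) => //= v.
exact: (cont_comp fc (continuous_coord (v := v))).
Qed.

Lemma within_comp (S T U : topologicalType) (A : set T) (c : S -> T) (g : T -> U) :
  {within A, continuous g} -> continuous c -> (forall x, A (c x)) ->
  continuous (fun x => g (c x)).
Proof.
move=> /subspace_continuousP gA cc Ac x B nB.
have /= := gA _ (Ac x) B nB; rewrite /within /= => /(cc x).
by apply: (@filterS _ (nbhs x)) => y /=; apply.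
Qed.

(** * Retractions onto the interval and the square *)

Section Clamp.
Variable R : realType.
Implicit Types (x : R) (p : R * R).

(** Precomposition with this retraction turns continuity within the interval or the square into
    continuity everywhere, so subspace topologies disappear from the constructions. *)
Definition clamp x : R := Num.max 0 (Num.min 1 x).

Definition clamp2 p : R * R := (clamp p.1, clamp p.2).

Lemma unitIP x : unitI R x <-> 0 <= x /\ x <= 1.
Proof. by rewrite /unitI /= in_itv /=; split => [/andP|[-> ->]]. Qed.

Lemma clamp_in x : unitI R (clamp x).
Proof.
apply/unitIP; rewrite /clamp le_max lexx ge_max ler01 /=; split => //.
by rewrite ge_min lexx.
Qed.

Lemma clamp_id x : unitI R x -> clamp x = x.
Proof. by case/unitIP => x0 x1; rewrite /clamp min_r // max_r. Qed.

Lemma clamp_le0 x : x <= 0 -> clamp x = 0.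
Proof. by move=> x0; rewrite /clamp max_l // ge_min x0 orbT. Qed.

Lemma clamp_ge1 x : 1 <= x -> clamp x = 1.
Proof. by move=> x0; rewrite /clamp min_l // max_r. Qed.

Lemma clamp2_in p : unitI2 R (clamp2 p).
Proof. by split; exact: clamp_in. Qed.

Lemma clamp2_id p : unitI2 R p -> clamp2 p = p.
Proof. by case: p => x y [/= px py]; rewrite /clamp2 !clamp_id. Qed.

Lemma continuous_clamp (T : topologicalType) (f : T -> R) :
  continuous f -> continuous (fun t => clamp (f t)).
Proof. by move=> cf; rewrite /clamp; cont. Qed.

Lemma continuous_clamp2 : continuous clamp2.
Proof. by apply: cont_pair; apply: continuous_clamp; cont. Qed.

Lemma compact_unitI2 : compact (unitI2 R).
Proof.
have -> : unitI2 R = unitI R `*` unitI R by [].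
by apply: compact_setX; exact: segment_compact.
Qed.

End Clamp.

Lemma finite_argmin (R : realType) (T : eqType) (f : T -> \bar R) (A : set T) :
  finite_set A -> A !=set0 ->
  exists2 x, A x & forall y, A y -> (f x <= f y)%E.
Proof.
move=> /finite_seqP[s ->]; elim: s => [[x]|x s IH _]; first by rewrite /= in_nil.
have [[y ys]|s0] := pselect ([set` s] !=set0); last first.
  exists x; first by rewrite /= mem_head.
  by move=> y; rewrite /= in_cons => /orP[/eqP->//|ys]; case: s0; exists y.
have [|z zs zP] := IH; first by exists y.
have [xz|zx] := leP (f x) (f z).
  exists x; first by rewrite /= mem_head.
  move=> w; rewrite /= in_cons => /orP[/eqP->//|ws].
  exact: le_trans xz (zP _ ws).
exists z; first by rewrite /= in_cons zs orbT.
by move=> w; rewrite /= in_cons => /orP[/eqP->|/zP//]; exact: ltW.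
Qed.

(** * Bad simplices and their obstruction complexes *)

Section Obstruction.
Variables (R : realType) (Z : choiceType) (d : Z -> Z -> \bar R).
Variables (X Y : set Z) (r : R).
Hypothesis dP : pseudometric d.
Hypothesis XYT : X `|` Y = setT.
Hypothesis finA : finite_set (X `&` Y).
Hypothesis r_ge0 : 0 <= r.
Hypothesis gluing : metric_gluing d X Y.
Hypothesis ssa : strong_simplex_assumption d r X Y.

Local Notation A := (X `&` Y).
Local Notation L := (VR d r setT).
Local Notation K := (VR d r X `|` VR d r Y).
Local Notation good := (Pgood d r X Y).

Definition close (x y : Z) : Prop := (d x y <= r%:E)%E.

Lemma closexx x : close x x.
Proof. by case: dP => _ dxx _ _; rewrite /close dxx lee_fin. Qed.

Lemma close_sym x y : close x y -> close y x.
Proof. by case: dP => _ _ dC _; rewrite /close dC. Qed.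

Lemma VR_close s x y : L s -> s x -> s y -> close x y.
Proof. by case=> _ _ _; apply. Qed.

Lemma VRI s : finite_set s -> s !=set0 ->
  (forall x y, s x -> s y -> close x y) -> L s.
Proof. by move=> fs s0 sc; split. Qed.

Lemma VR_sub s s' : L s -> s' `<=` s -> s' !=set0 -> L s'.
Proof.
case=> fs _ _ sc s's s'0; apply: VRI => //; first exact: sub_finite_set fs.
by move=> x y /s's sx /s's sy; exact: sc.
Qed.

Lemma K_sub s s' : K s -> s' `<=` s -> s' !=set0 -> K s'.
Proof.
move=> Ks s's s'0; case: Ks => -[fs _ sX sc]; [left|right];
  (split=> //; [exact: sub_finite_set fs|exact: subset_trans sX|]);
  by move=> x y /s's sx /s's sy; exact: sc.
Qed.

Lemma K_good s : K s -> good s.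
Proof.
move=> Ks; split; first exact: VR_union_sub Ks.
by case: Ks => -[_ _ sX _]; [apply: Or31|apply: Or32].
Qed.

Lemma notA_bad s v : L s -> ~ good s -> s v -> ~ A v.
Proof. by move=> Ls + sv Av; apply; split => //; apply: Or33; exists v. Qed.

(** Reduces bad simplices to bad edges, the only ones of which the strong simplex assumption
    speaks. *)
Lemma bad_edge s : L s -> ~ good s ->
  exists x y, [/\ s x, s y, X x /\ ~ Y x & Y y /\ ~ X y].
Proof.
move=> Ls bs.
have XorY z : X z \/ Y z by have : [set: Z] z by []; rewrite -XYT.
have [y [sy nXy]] : exists y, s y /\ ~ X y.
  apply: contrapT => nE; apply: bs; split => //; apply: Or31 => y sy.
  by apply: contrapT => nX; apply: nE; exists y.
have [x [sx nYx]] : exists x, s x /\ ~ Y x.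
  apply: contrapT => nE; apply: bs; split => //; apply: Or32 => x sx.
  by apply: contrapT => nX; apply: nE; exists x.
by exists x, y; split => //; split => //; [case: (XorY x)|case: (XorY y)].
Qed.

Lemma pair_bad x y : close x y -> X x /\ ~ Y x -> Y y /\ ~ X y ->
  L [set x; y] /\ ~ good [set x; y].
Proof.
move=> xy [Xx nYx] [Yy nXy]; split.
  apply: VRI => //; first by exists x; left.
  by move=> u v [->|->] [->|->] //; [exact: closexx|exact: close_sym|exact: closexx].
case=> _ [/(_ y)|/(_ x)|[v [[->|->] []]]] //.
  by move=> H; apply: nXy; apply: H; right.
by move=> H; apply: nYx; apply: H; left.
Qed.

Lemma ssa_edge x y v a b : close x y -> X x /\ ~ Y x -> Y y /\ ~ X y ->
  v = x \/ v = y -> A a -> A b -> close a v -> close v b ->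
  (2%:E * d a b <= d a v + d v b)%E.
Proof.
move=> xy Xx Yy vxy Aa Ab av vb.
have [Le be] := pair_bad xy Xx Yy.
apply: (ssa Le be) => //.
by exists x, y; split => // E; case: Yy => _; apply; rewrite -E; case: Xx.
Qed.

(** At a vertex x of a bad edge of [s], the assumption bounds 2 d(a,b) by d(a,x) + d(x,b), which is
    at most 2r. *)
Lemma close_near_bad s a b : L s -> ~ good s -> A a -> A b ->
  (forall v, s v -> close a v) -> (forall v, s v -> close b v) -> close a b.
Proof.
move=> Ls bs Aa Ab sa sb; have [x [y [sx sy Xx Yy]]] := bad_edge Ls bs.
have xy := VR_close Ls sx sy.
have := ssa_edge xy Xx Yy (or_introl erefl) Aa Ab (sa _ sx) (close_sym (sb _ sx)).
have H : (d a x + d x b <= (r + r)%:E)%E.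
  by rewrite EFinD; apply: leeD; [exact: sa|exact: close_sym (sb _ sx)].
move=> /le_trans => /(_ _ H); rewrite /close.
case: dP => d0 _ _ _; case: (d a b) (d0 a b) => [t| |] //.
  rewrite -EFinM !lee_fin => _ H'; lra.
by rewrite gt0_muley // lte_fin.
Qed.

(** Finiteness of A makes the gluing infimum a minimum. For empty A it would be [+oo], against
    closeness of x and y. *)
Lemma gluing_attained x y : X x /\ ~ Y x -> Y y /\ ~ X y -> close x y ->
  exists2 a, A a & (d x a + d a y <= r%:E)%E.
Proof.
move=> [Xx nYx] [Yy nXy]; rewrite /close gluing //; [|by case|by case].
have [A0|A0] := pselect (A !=set0).
  have [a Aa aP] := finite_argmin (fun a => d x a + d a y)%E finA A0.
  move=> H; exists a => //; apply: le_trans H.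
  by apply: le_ereal_inf_tmp => _ [b Ab <-]; exact: aP.
have -> : A = set0 by apply/seteqP; split => // z Az; case: A0; exists z.
by rewrite image_set0 ereal_inf0 leye_eq.
Qed.

(* Among the points of A through which the distances from x are realized, a
   nearest one to x is close to everything, by the strong simplex assumption
   at x. *)
Lemma star_apex x (T : set Z) : T !=set0 ->
  (forall y, T y -> exists2 a, A a & (d x a + d a y <= r%:E)%E) ->
  (forall a b, A a -> A b -> close a x -> close x b ->
     (2%:E * d a b <= d a x + d x b)%E) ->
  exists2 a, A a & close a x /\ forall y, T y -> close a y.
Proof.
case: dP => d0 _ dC dT [y0 Ty0] TA xA.
pose B := A `&` [set a | exists2 y, T y & (d x a + d a y <= r%:E)%E].
have B0 : B !=set0.
  by have [a Aa ay] := TA _ Ty0; exists a; split => //; exists y0.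
have [|a [Aa [y Ty ay]] aP] := @finite_argmin _ _ (d x) B _ B0.
  by apply: sub_finite_set finA => z [].
have xle b z : (d x b + d b z <= r%:E)%E -> close x b.
  by move=> H; apply: le_trans H; rewrite leeDl.
exists a => //; split; first by apply: close_sym; exact: xle ay.
move=> y' Ty'; have [b Ab by'] := TA _ Ty'.
have ab : (d x a <= d x b)%E by apply: aP; split => //; exists y'.
have := xA _ _ Aa Ab (close_sym (xle _ _ ay)) (xle _ _ by').
rewrite (dC a x) => H.
(* The minimality of [a] and the factor 2 give this bound; then d(a,y') is at most d(a,b) + d(b,y'),
   hence at most d(x,b) + d(b,y'), which is at most r. *)
suff H2 : (d a b <= d x b)%E.
  by rewrite /close; apply: le_trans by'; apply: le_trans (dT a b y') _; rewrite leeD2r.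
have := xle _ _ by'; rewrite /close; move: ab H (d0 a b) (d0 x a).
case: (d x b) => [t| |] //; case: (d x a) => [u| |] //; case: (d a b) => [v| |] //.
  by rewrite -EFinM -EFinD !lee_fin => *; lra.
by rewrite gt0_muley // lte_fin.
Qed.

Definition one_sided (s : set Z) : Prop :=
  (exists x, s `&` X = [set x]) \/ (exists y, s `&` Y = [set y]).

(** The lone vertex forms a bad edge with each of the others. Gluing joins it to them through points
    of A, and [star_apex] at the lone vertex selects a single point that serves all. *)
Lemma cone_apex s : L s -> ~ good s -> one_sided s ->
  exists2 a, A a & forall v, s v -> close a v.
Proof.
move=> Ls bs [[x sXx]|[y sYy]]; have [x' [y' [sx' sy' Xx' Yy']]] := bad_edge Ls bs.
- have E : x' = x.
    have : (s `&` X) x' by split => //; case: Xx'.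
    by rewrite sXx.
  subst x'; pose T := s `&` [set y | y <> x].
  have TY y : T y -> Y y /\ ~ X y.
    move=> [sy yx]; have nXy : ~ X y.
      by move=> Xy; apply: yx; have : (s `&` X) y by []; rewrite sXx.
    by split => //; have : [set: Z] y by []; rewrite -XYT => -[].
  have [||a b Aa Ab|a Aa [ax aT]] := @star_apex x T.
  + by exists y'; split => // E; case: Yy' => _; apply; rewrite E; case: Xx'.
  + move=> y Ty; apply: gluing_attained; [by []|exact: TY|].
    by apply: (VR_close Ls) => //; case: Ty.
  + by apply: (@ssa_edge x y') => //; [exact: (VR_close Ls)|left].
  exists a => // v sv; have [->//|vx] := eqVneq v x.
  by apply: aT; split => //; apply/eqP.
- have E : y' = y.
    have : (s `&` Y) y' by split => //; case: Yy'.
    by rewrite sYy.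
  subst y'; pose T := s `&` [set x | x <> y].
  have TX x : T x -> X x /\ ~ Y x.
    move=> [sx xy]; have nYx : ~ Y x.
      by move=> Yx; apply: xy; have : (s `&` Y) x by []; rewrite sYy.
    by split => //; have : [set: Z] x by []; rewrite -XYT => -[].
  have [||a b Aa Ab|a Aa [ax aT]] := @star_apex y T.
  + by exists x'; split => // E; case: Xx' => _; apply; rewrite E; case: Yy'.
  + move=> x Tx; have [|||a Aa H] := @gluing_attained x y; [exact: TX|by []| |].
      by apply: (VR_close Ls) => //; case: Tx.
    by exists a => //; case: dP => _ _ dC _; rewrite addeC dC (dC y a).
  + by apply: (@ssa_edge x' y) => //; [exact: (VR_close Ls)|right].
  exists a => // v sv; have [->//|vx] := eqVneq v y.
  by apply: aT; split => //; apply/eqP.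
Qed.

(** Smallness is expressed by two vertices on each side and not by a cardinality, which suits images
    under vertex maps that need not be injective. *)
Lemma small_one_sided s : L s -> ~ good s ->
  ~ (exists x x' y y', [/\ [/\ s x, s x', s y & s y'],
       x <> x', y <> y', X x /\ X x' & Y y /\ Y y']) ->
  one_sided s.
Proof.
move=> Ls bs small; have [x [y [sx sy [Xx nYx] [Yy nXy]]]] := bad_edge Ls bs.
have [H|H] := pselect (forall x', s x' -> X x' -> x' = x).
  left; exists x; apply/seteqP; split => [x' []|_ ->//]; exact: H.
right; exists y; apply/seteqP; split => [y' [sy' Yy']|_ ->//] /=.
apply: contrapT => yy'; apply: H => x' sx' Xx'; apply: contrapT => xx'.
by apply: small; exists x', x, y', y; split.
Qed.

(** The preference for A in the third clause matters for a good simplex with a bad face: it must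
    meet A, so its center is in A just as that of the face. *)
Definition center_spec (s : set Z) (a : Z) : Prop :=
  [/\ forall v, s v -> close a v, good s -> s a,
      good s -> s `&` A !=set0 -> A a & ~ good s -> A a].

Lemma center_exists : Z ->
  exists c : set Z -> Z, forall s, L s -> (~ good s -> one_sided s) ->
    center_spec s (c s).
Proof.
move=> z0.
have /choice[c cP] : forall s : set Z, exists a,
    L s -> (~ good s -> one_sided s) -> center_spec s a.
  (* [z0] is the default value where the specification asks for nothing. *)
  move=> s; have [Ls|nL] := pselect (L s); last by exists z0.
  have [gs|bs] := pselect (good s).
    have [[a [sa Aa]]|nA] := pselect (s `&` A !=set0).
      by exists a => _ _; split => // v sv; exact: (VR_close Ls).
    by case: (Ls) => _ [a sa] _ _; exists a => _ _; split => // v sv; exact: (VR_close Ls).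
  have [os|nos] := pselect (one_sided s); last by exists z0 => _ /(_ bs).
  by have [a Aa sa] := cone_apex Ls bs os; exists a.
by exists c.
Qed.

(** If [s] is good, its center is a vertex of [s']. If [s] is bad, both centers lie in A and are
    close to all of [s], so [close_near_bad] applies. *)
Lemma center_close s s' a a' : L s -> L s' -> s `<=` s' ->
  center_spec s a -> center_spec s' a' -> close a a'.
Proof.
move=> Ls Ls' ss' [sa gsa _ bA] [s'a' gs'a' gA' bA'].
have [gs|bs] := pselect (good s).
  by apply: close_sym; apply: s'a'; apply: ss'; exact: gsa.
have Aa' : A a'.
  have [gs'|/bA'//] := pselect (good s').
  apply: gA' => //; case: (gs') => _ [s'X|s'Y|//].
    by case: bs; split => //; apply: Or31; exact: subset_trans s'X.
  by case: bs; split => //; apply: Or32; exact: subset_trans s'Y.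
by apply: (close_near_bad Ls bs) => //; [exact: bA|move=> v /ss'; exact: s'a'].
Qed.

(** A center outside A belongs to a simplex lying wholly in X or wholly in Y. For two such
    simplices, the center of the smaller lies in the larger, so opposite sides would put a center
    into A. *)
Lemma chain_centers (F : set (set Z)) (c : set Z -> Z) :
  (forall s, F s -> center_spec s (c s)) ->
  (forall s s', F s -> F s' -> s `<=` s' \/ s' `<=` s) ->
  (forall s, F s -> X (c s)) \/ (forall s, F s -> Y (c s)).
Proof.
move=> FP Fch.
have [[s0 [Fs0 nA0]]|nE] := pselect (exists s0, F s0 /\ ~ A (c s0)); last first.
  left=> s Fs; suff [] : A (c s) by [].
  by apply: contrapT => nA; apply: nE; exists s.
have goodF s : F s -> ~ A (c s) -> [/\ good s, s (c s) & s `<=` X \/ s `<=` Y].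
  move=> Fs nA; have [_ gs gA bA] := FP _ Fs.
  have [g|/bA//] := pselect (good s); split => //; first exact: gs.
  by case: (g) => _ [|| /(gA g)//]; [left|right].
have [_ s0c0 s0XY] := goodF _ Fs0 nA0.
case: s0XY => s0X; [left|right] => s Fs.
- have [[]//|nA] := pselect (A (c s)).
  have [_ sc [sX|sY]] := goodF _ Fs nA; first exact: sX.
  case: (Fch _ _ Fs Fs0) => ss; first by apply: s0X; apply: ss.
  by case: nA0; split; [exact: s0X|apply: sY; exact: ss].
- have [[]//|nA] := pselect (A (c s)).
  have [_ sc [sX|sY]] := goodF _ Fs nA; last exact: sY.
  case: (Fch _ _ Fs Fs0) => ss; first by apply: s0X; apply: ss.
  by case: nA0; split; [apply: sX; exact: ss|exact: s0X].
Qed.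

Lemma contractible_St s : L s -> ~ good s -> one_sided s ->
  contractible R (geom R (St L s A)).
Proof.
move=> Ls bs os; have [a Aa sa] := cone_apex Ls bs os.
pose N := A `&` [set b | forall v, s v -> close b v].
(* The obstruction complex is the full simplex on [N]: any two points of [N] are close by
   [close_near_bad]. It is then contracted linearly to the vertex [a]. *)
have StE mu : St L s A mu <-> mu `<=` N /\ mu !=set0.
  split=> [[muA mu0 _ Lmu]|[muN mu0]].
    split=> // b mub; split; first exact: muA.
    by move=> v sv; apply: (VR_close Lmu); [left|right].
  have fmu : finite_set mu by apply: sub_finite_set finA => b /muN[].
  split => //; first by move=> b /muN[].
  case: (Ls) => fs _ _ sc; apply: VRI.
  - by rewrite finite_setU.
  - by case: mu0 => b mub; exists b; left.
  - move=> x y [/muN[Ax sx]|sx] [/muN[Ay sy]|sy].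
    + exact: (close_near_bad Ls bs).
    + exact: sx.
    + by apply: close_sym; exact: sy.
    + exact: sc.
pose da (v : Z) : R := (v == a)%:R.
have sda : supp da = [set a].
  by apply/seteqP; split => v; rewrite /supp /= /da pnatr_eq0 eqb0 negbK => /eqP.
have daP : real_pt (St L s A) da.
  split; first by move=> v; rewrite ler0n.
    rewrite sda; apply/StE; split; last by exists a.
    by move=> _ ->; split.
  by rewrite sda fsbig_set1 /da eqxx.
pose n (p : R * geom R (St L s A)) v := (1 - clamp p.1) * sval p.2 v + clamp p.1 * da v.
have cl p : 0 <= clamp p /\ clamp p <= 1 :> R by apply/unitIP; exact: clamp_in.
have [F FN] : exists F : {fset Z}, N = [set` F].
  by apply/finite_fsetP; apply: sub_finite_set finA => b [].
have suppN (t : geom R (St L s A)) v : v \notin F -> sval t v = 0.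
  move=> vF; apply/eqP; apply: contraNT vF => tv.
  have /StE[tN _] := geom_supp t.
  by have := tN _ tv; rewrite FN.
have nF p v : v \notin F -> n p v = 0.
  move=> vF; rewrite /n (suppN p.2) // mulr0 add0r /da.
  case: eqP => [va|_]; last by rewrite mulr0.
  have : N a by [].
  by rewrite FN /= -va (negbTE vF).
have n0 p v : 0 <= n p v.
  have [c0 c1] := cl p.1.
  by rewrite addr_ge0 // mulr_ge0 // ?subr_ge0 // ?ler0n //; exact: geom_ge0.
have sum1 (t : Z -> R) : real_pt (St L s A) t -> (forall v, v \notin F -> t v = 0) ->
    \sum_(v <- F) t v = 1.
  move=> [_ _ <-] tF; rewrite (fsbig_fwiden F) //.
    by move=> v /=; apply: contraNT => /tF ->.
  by move=> v [/= vF] /negP; rewrite negbK => /eqP ->.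
(* The weights already sum to 1, so the normalization in [conic_map] changes nothing at either end
   of the contraction. *)
have nsum p : \sum_(v <- F) n p v = 1.
  rewrite big_split /= -!mulr_sumr (sum1 (sval p.2)); [|exact: (svalP p.2)|exact: suppN].
  rewrite (sum1 da) //; first by ring.
  by move=> v vF; have := suppN (exist _ _ daP) v vF.
have nK p : St L s A (supp (n p)).
  apply/StE; split.
    rewrite FN => v /=; rewrite /supp /=; apply: contraNT => /nF -> //.
  apply: contrapT => H; have := nsum p; rewrite big1 ?(@eq_sym _ 0 1).
    by move/eqP; rewrite eq_sym oner_eq0.
  move=> v _; apply: contrapT => /eqP nv; apply: H; by exists v.
have nc v : continuous (fun p => n p v).
  rewrite /n; apply: contD; apply: contM; cont.
  by move=> q; apply: (cont_comp _ (continuous_coord (v := v))); cont.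
have [|H Hc HE] := @conic_map R Z (St L s A) _ F n _ n0 nc nF nK.
  by move=> mu /StE[].
split; first by constructor; exact: (exist _ _ daP).
exists (exist _ _ daP), H; split.
- exact: continuous_subspaceT.
- move=> t; apply: geom_eq => v; rewrite HE nsum divr1 /n /=.
  by rewrite clamp_le0 // subr0 mul1r mul0r addr0.
- move=> t; apply: geom_eq => v; rewrite HE nsum divr1 /n /=.
  by rewrite clamp_ge1 // subrr mul1r mul0r add0r.
Qed.

End Obstruction.

(** * Simplicial approximation on the square *)

(** Lebesgue number of the cover of the square by the preimages of the open vertex stars. *)
Lemma lebesgue_number (R : realType) (Z : choiceType) (K : set (set Z))
  (g : R * R -> geom R K) :
  (forall s, K s -> s !=set0) -> continuous g ->
  exists2 e : R, 0 < e & forall q, unitI2 R q -> exists v, forall p,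
    `|p.1 - q.1| < e -> `|p.2 - q.2| < e -> sval (g p) v != 0.
Proof.
move=> K0 gc.
pose P (e : R) (q : R * R) := exists v, forall p,
    `|p.1 - q.1| < e -> `|p.2 - q.2| < e -> sval (g p) v != 0.
have /compact_near_coveringP cov := @compact_unitI2 R.
have : \forall e \near (0 : R)^'+, unitI2 R `<=` P e.
  apply: cov => q0 _; have [v /= gv] := K0 _ (geom_supp (g q0)).
  have cv : continuous (fun p => sval (g p) v).
    exact: (cont_comp gc (continuous_coord (v := v))).
  have : nbhs (sval (g q0) v) [set x : R | x != 0].
    by apply: open_nbhs_nbhs; split => //; exact: open_neq.
  move=> /(cv q0) /nbhs_ballP[e /= e0 eP].
  (* Half of the radius is spent on the distance from [q0] to [q], the other half on that from [q]
     to [p]. *)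
  exists (ball q0 (e / 2), [set x : R | x < e / 2]) => /=.
    split; first by apply: nbhsx_ballx; rewrite divr_gt0.
    by apply: nbhs_right_lt; rewrite divr_gt0.
  case=> q x /= [[q1 q2] xe]; exists v => p p1 p2; apply: eP; split => /=.
    rewrite /ball /= in q1 *; rewrite (splitr e).
    apply: le_lt_trans (ltrD q1 (lt_trans p1 xe)).
    by rewrite (distrC p.1); exact: ler_distD.
  rewrite /ball /= in q2 *; rewrite (splitr e).
  apply: le_lt_trans (ltrD q2 (lt_trans p2 xe)).
  by rewrite (distrC p.2); exact: ler_distD.
move=> H; have : \forall e \near (0 : R)^'+, 0 < e /\ unitI2 R `<=` P e.
  by near=> e; split; [near: e; exact: nbhs_right_gt|near: e].
by move=> /filter_ex[e [e0 eP]]; exists e.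
Unshelve. all: by end_near. Qed.

Lemma mod3_neq (s s' : nat) : s != s' -> (s <= s' + 2)%N -> (s' <= s + 2)%N ->
  (s %% 3 != s' %% 3)%N.
Proof.
wlog ss : s s' / (s <= s')%N.
  move=> H; case: (leqP s s') => [|/ltnW] ss ne h1 h2; first exact: H.
  by rewrite eq_sym; apply: H => //; rewrite eq_sym.
move=> ne _ h; rewrite eq_sym -(subnKC ss) -[X in _ != X %[mod _]]addn0 eqn_modDl.
have : (0 < s' - s <= 2)%N by rewrite subn_gt0 ltn_neqAle ne ss leq_subLR.
by case: (s' - s)%N => [|[|[|]]].
Qed.

(** Up to sign, neighbours in the triangulated grid differ by (1,0), (0,1) or (1,1), so i + j
    changes by 1 or 2. Hence i + j modulo 3 is a proper colouring with three colours. *)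
Lemma grid_neighbours (i j i' j' : nat) : (i < i' + 2)%N -> (i' < i + 2)%N ->
  (j < j' + 2)%N -> (j' < j + 2)%N -> (i + j' < i' + j + 2)%N ->
  (i' + j < i + j' + 2)%N -> (i != i') || (j != j') ->
  ((i + j) %% 3 != (i' + j') %% 3)%N.
Proof. by move=> *; apply: mod3_neq; lia. Qed.

(* These are the nodal functions of a square grid triangulated by the diagonals
   parallel to x = y. *)
Lemma hat_functions (R : realType) (e : R) : 0 < e ->
  exists (W : finType) (c : W -> R * R) (mu : W -> R * R -> R),
  [/\ forall w, unitI2 R (c w), forall w, continuous (mu w),
      forall w p, 0 <= mu w p &
      forall p, unitI2 R p -> exists w, 0 < mu w p] /\
  (forall w p, 0 < mu w p -> `|p.1 - (c w).1| < e /\ `|p.2 - (c w).2| < e) /\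
  (forall p w1 w2 w3 w4, uniq [:: w1; w2; w3; w4] ->
     0 < mu w1 p -> 0 < mu w2 p -> 0 < mu w3 p -> 0 < mu w4 p -> False).
Proof.
move=> e0; pose n := (Num.truncn e^-1).+1.
have ne : e^-1 < n%:R by exact: truncnS_gt.
have n0 : 0 < n%:R :> R by rewrite ltr0n.
pose W := ('I_n.+1 * 'I_n.+1)%type.
pose a (w : W) (p : R * R) := n%:R * p.1 - w.1%:R.
pose b (w : W) (p : R * R) := n%:R * p.2 - w.2%:R.
pose mu w p := Num.max 0
  (1 - Num.max `|a w p| (Num.max `|b w p| `|a w p - b w p|)).
have muP w p : 0 < mu w p -> [/\ `|a w p| < 1, `|b w p| < 1 & `|a w p - b w p| < 1].
  by rewrite /mu lt_max ltxx /= subr_gt0 !gt_max => /and3P[].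
have muP' w p : `|a w p| < 1 -> `|b w p| < 1 -> `|a w p - b w p| < 1 -> 0 < mu w p.
  by move=> *; rewrite /mu lt_max ltxx /= subr_gt0 !gt_max; apply/and3P.
exists W, (fun w : W => ((w.1 : nat)%:R / n%:R, (w.2 : nat)%:R / n%:R)), mu; split; last split.
- split.
  + case=> i j; split; apply/unitIP; rewrite /= divr_ge0 ?ler0n //; split=> //;
      by rewrite ler_pdivrMr // mul1r ler_nat -ltnS.
  + move=> w; have ca : continuous (a w).
      apply: contB; last exact: cst_continuous.
      by apply: contM; [exact: cst_continuous|move=> ?; exact: cvg_fst].
    have cb : continuous (b w).
      apply: contB; last exact: cst_continuous.
      by apply: contM; [exact: cst_continuous|move=> ?; exact: cvg_snd].
    apply: cont_max; first exact: cst_continuous.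
    apply: contB; first exact: cst_continuous.
    apply: cont_max; first exact: cont_norm.
    by apply: cont_max; apply: cont_norm => //; apply: contB.
  + by move=> w p; rewrite /mu le_max lexx.
  + move=> [x y] [/= /unitIP[x0 x1] /unitIP[y0 y1]].
    (* The function of the lower left node of the cell is positive, since both fractional parts lie
       in [0, 1). The index [n] itself occurs at [z = 1]. *)
    have tr (z : R) : 0 <= z -> z <= 1 -> exists i : 'I_n.+1,
        0 <= n%:R * z - i%:R /\ n%:R * z - i%:R < 1.
      move=> z0 z1; have nz0 : 0 <= n%:R * z by rewrite mulr_ge0.
      have iP : (Num.truncn (n%:R * z) < n.+1)%N.
        rewrite ltnS truncn_le_nat; apply: le_lt_trans (_ : n%:R < _).
          by rewrite ler_piMr.
        by rewrite ltr_nat.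
      exists (Ordinal iP) => /=; have /andP[] := truncn_itv nz0.
      by rewrite -natr1 => *; split; lra.
    have [i [i0 i1]] := tr x x0 x1; have [j [j0 j1]] := tr y y0 y1.
    exists (i, j); apply: muP'; rewrite /a /b /= ltr_norml; apply/andP; split; lra.
- move=> w p /muP[aw bw _].
  have H (z : R) (i : nat) : `|n%:R * z - i%:R| < 1 -> `|z - i%:R / n%:R| < e.
    move=> H; have -> : z - i%:R / n%:R = (n%:R * z - i%:R) / n%:R.
      by field; rewrite gt_eqF.
    rewrite normrM normfV (gtr0_norm n0) ltr_pdivrMr //.
    apply: lt_trans H _; rewrite -ltr_pdivrMl // mulr1 //.
  by split; exact: H.
- have pair w w' p : w != w' -> 0 < mu w p -> 0 < mu w' p ->
      ((w.1 + w.2) %% 3 != (w'.1 + w'.2) %% 3)%N.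
    case: w w' => [[i hi] [j hj]] [[i' hi'] [j' hj']] ne'.
    move=> /muP[] /=; rewrite /a /b /= !ltr_norml => /andP[a1 a2] /andP[b1 b2] /andP[c1 c2].
    move=> /muP[] /=; rewrite /a /b /= !ltr_norml => /andP[a1' a2'] /andP[b1' b2'] /andP[c1' c2'].
    have h1 : (i < i' + 2)%N by rewrite -(ltr_nat R) natrD; lra.
    have h2 : (i' < i + 2)%N by rewrite -(ltr_nat R) natrD; lra.
    have h3 : (j < j' + 2)%N by rewrite -(ltr_nat R) natrD; lra.
    have h4 : (j' < j + 2)%N by rewrite -(ltr_nat R) natrD; lra.
    have h5 : (i + j' < i' + j + 2)%N by rewrite -(ltr_nat R) !natrD; lra.
    have h6 : (i' + j < i + j' + 2)%N by rewrite -(ltr_nat R) !natrD; lra.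
    have h7 : (i != i') || (j != j').
      by rewrite -negb_and; apply: contra ne' => /andP[/eqP ii /eqP jj];
        apply/eqP; congr pair; exact: val_inj.
    exact: grid_neighbours.
  move=> p w1 w2 w3 w4 /=; rewrite !inE !negb_or andbT.
  move=> /and3P[/and3P[n12 n13 n14] /andP[n23 n24] n34] m1 m2 m3 m4.
  (* Four functions positive at one point would need four different colours modulo 3. *)
  pose s := [seq ((w.1 + w.2) %% 3)%N | w : W <- [:: w1; w2; w3; w4]].
  have Us : uniq s.
    rewrite /= !inE !negb_or (pair _ _ p n12) // (pair _ _ p n13) //.
    by rewrite (pair _ _ p n14) // (pair _ _ p n23) // (pair _ _ p n24) // (pair _ _ p n34).
  have s3 : {subset s <= iota 0 3} by move=> x /mapP[w _ ->]; rewrite mem_iota ltn_mod.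
  by have := uniq_leq_size Us s3.
Qed.

(** * Barycentric coordinates on flags *)

Section Subdivision.
Variables (R : realType) (W : finType).
Implicit Types (m : W -> R) (S : {set W}).

(* Nonzero exactly on the sets S of positive coordinates that dominate the
   coordinates outside S, i.e. on a flag of superlevel sets of m: these are
   unnormalized barycentric coordinates in the first subdivision. *)
Definition flag_weight S m : R :=
  (\prod_(w in S) m w) *
  \prod_(w in S) \prod_(w' in ~: S) Num.max 0 (m w - m w').

Lemma flag_weight_ge0 S m : (forall w, 0 <= m w) -> 0 <= flag_weight S m.
Proof.
move=> m0; rewrite /flag_weight mulr_ge0 ?prodr_ge0 // => w _.
by rewrite prodr_ge0 // => w' _; rewrite le_max lexx.
Qed.

Lemma flag_weight_neq0 S m : (forall w, 0 <= m w) -> flag_weight S m != 0 ->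
  (forall w, w \in S -> 0 < m w) /\
  (forall w w', w \in S -> w' \notin S -> m w' < m w).
Proof.
move=> m0; rewrite /flag_weight mulf_eq0 negb_or.
rewrite !prodf_seq_neq0 => /andP[/allP P1 /allP P2]; split.
  move=> w wS; have := P1 w (mem_index_enum w); rewrite wS /=.
  by rewrite lt_neqAle m0 andbT eq_sym.
move=> w w' wS w'S; have := P2 w (mem_index_enum w); rewrite wS /=.
rewrite prodf_seq_neq0 => /allP/(_ w' (mem_index_enum w')).
rewrite inE w'S /=; apply: contraNT; rewrite -leNgt => mm.
by rewrite max_l // subr_le0.
Qed.

Lemma flag_weight_chain S S' m : (forall w, 0 <= m w) ->
  flag_weight S m != 0 -> flag_weight S' m != 0 -> S \subset S' \/ S' \subset S.
Proof.
move=> m0 /(flag_weight_neq0 m0)[_ SP] /(flag_weight_neq0 m0)[_ S'P].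
have [|/fintype.subsetPn[w wS wS']] := boolP (S \subset S'); first by left.
right; apply/fintype.subsetP => w' w'S'; apply: contraT => w'S.
by have := lt_trans (SP _ _ wS w'S) (S'P _ _ w'S' wS'); rewrite ltxx.
Qed.

(** The set of all maximizers of [m] is a superlevel set, and its weight is a product of positive
    factors. *)
Lemma flag_weight_exists m : (forall w, 0 <= m w) -> (exists w, 0 < m w) ->
  exists2 S, S != finset.set0 & 0 < flag_weight S m.
Proof.
move=> m0 [w0 mw0]; pose w1 := [arg max_(w > w0) m w]%O.
have w1P w : m w <= m w1.
  by rewrite /w1; case: Order.TotalTheory.arg_maxP => // i _; apply.
pose S : {set W} := [set w | m w == m w1]%SET; exists S.
  by apply/finset.set0Pn; exists w1; rewrite inE.
rewrite mulr_gt0 // prodr_gt0 // => w; rewrite inE => /eqP wE.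
  by rewrite wE; exact: lt_le_trans (w1P w0).
rewrite prodr_gt0 // => w'; rewrite !inE => w'E.
by rewrite lt_max ltxx /= subr_gt0 wE lt_neqAle w'E w1P.
Qed.

Lemma flag_weight_continuous (T : topologicalType) (mu : W -> T -> R) S :
  (forall w, continuous (mu w)) ->
  continuous (fun p => flag_weight S (fun w => mu w p)).
Proof.
move=> cmu; apply: contM; first exact: (cont_prod (f := mu)).
apply: cont_prod => w; apply: cont_prod => w'.
by apply: cont_max; [exact: cst_continuous|apply: contB].
Qed.

End Subdivision.

Lemma sumr_neq0 (R : realType) (I : finType) (P : pred I) (f : I -> R) :
  \sum_(i | P i) f i != 0 -> exists2 i, P i & f i != 0.
Proof.
move=> H; apply: contrapT => nE; move/negP: H; apply; apply/eqP.
apply: big1 => i Pi; apply/eqP; apply: contraT => fi.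
by case: nE; exists i.
Qed.

(** * The three stages at a single point of the square *)

Section Push.
Variables (R : realType) (Z : choiceType) (d : Z -> Z -> \bar R).
Variables (X Y : set Z) (r : R).
Hypothesis dP : pseudometric d.
Hypothesis XYT : X `|` Y = setT.
Hypothesis finA : finite_set (X `&` Y).
Hypothesis r_ge0 : 0 <= r.
Hypothesis gluing : metric_gluing d X Y.
Hypothesis ssa : strong_simplex_assumption d r X Y.

Local Notation A := (X `&` Y).
Local Notation L := (VR d r setT).
Local Notation K := (VR d r X `|` VR d r Y).
Local Notation good := (Pgood d r X Y).
Local Notation close := (close d r).

Section Stages.
Variables (W : finType) (V : W -> Z) (cc : set Z -> Z).
Hypothesis ccP : forall s, L s -> (~ good s -> one_sided X Y s) ->
  center_spec d X Y r s (cc s).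
Implicit Types (m : W -> R) (S : {set W}) (z : Z).

Definition vertices S : set Z := [set V w | w in [set` S]].

Definition stage1 m z : R := \sum_w m w * (z == V w)%:R.

(** The threshold separates triangles from edges. The center of a triangle is close to all vertices
    present, so it can be introduced at once; sets of at most two elements keep their vertices until
    [stage3]. *)
Definition stage2 m z : R := \sum_(S : {set W} | S != finset.set0)
  flag_weight S m * (if (#|S| <= 2)%N then \sum_(w in S) (z == V w)%:R
                     else (z == cc (vertices S))%:R).

Definition stage3 m z : R := \sum_(S : {set W} | S != finset.set0)
  flag_weight S m * (z == cc (vertices S))%:R.

Variables (m : W -> R) (s0 : set Z).
Hypothesis m_ge0 : forall w, 0 <= m w.
Hypothesis m_pos : exists w, 0 < m w.
Hypothesis m_four : forall w1 w2 w3 w4, uniq [:: w1; w2; w3; w4] ->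
  0 < m w1 -> 0 < m w2 -> 0 < m w3 -> 0 < m w4 -> False.
Hypothesis Ls0 : L s0.
Hypothesis Vs0 : forall w, 0 < m w -> s0 (V w).

Lemma stage1_ge0 z : 0 <= stage1 m z.
Proof. by apply: sumr_ge0 => w _; rewrite mulr_ge0 ?ler0n. Qed.

Lemma stage2_ge0 z : 0 <= stage2 m z.
Proof.
apply: sumr_ge0 => S _; rewrite mulr_ge0 ?flag_weight_ge0 //.
by case: ifP => _; rewrite ?ler0n // sumr_ge0 // => w _; rewrite ler0n.
Qed.

Lemma stage3_ge0 z : 0 <= stage3 m z.
Proof. by apply: sumr_ge0 => S _; rewrite mulr_ge0 ?flag_weight_ge0 ?ler0n. Qed.

Lemma stage1_neq0 z : stage1 m z != 0 -> exists2 w, 0 < m w & z = V w.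
Proof.
move=> /sumr_neq0[w _]; rewrite mulf_eq0 negb_or pnatr_eq0 eqb0 negbK.
by move=> /andP[mw /eqP ->]; exists w => //; rewrite lt_neqAle eq_sym mw m_ge0.
Qed.

Lemma stage2_neq0 z : stage2 m z != 0 ->
  exists S, [/\ S != finset.set0, flag_weight S m != 0 &
    if (#|S| <= 2)%N then exists2 w, w \in S & z = V w else z = cc (vertices S)].
Proof.
move=> /sumr_neq0[S S0]; rewrite mulf_eq0 negb_or => /andP[Sm H].
exists S; split => //; case: ifP H => _.
  by move=> /sumr_neq0[w wS]; rewrite pnatr_eq0 eqb0 negbK => /eqP ->; exists w.
by rewrite pnatr_eq0 eqb0 negbK => /eqP.
Qed.

Lemma stage3_neq0 z : stage3 m z != 0 ->
  exists S, [/\ S != finset.set0, flag_weight S m != 0 & z = cc (vertices S)].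
Proof.
move=> /sumr_neq0[S S0]; rewrite mulf_eq0 negb_or => /andP[Sm].
by rewrite pnatr_eq0 eqb0 negbK => /eqP ->; exists S.
Qed.

Lemma stage1_pos : exists z, stage1 m z != 0.
Proof.
have [w mw] := m_pos; exists (V w); rewrite gt_eqF // /stage1 (bigD1 w) //= eqxx mulr1.
by rewrite ltr_wpDr // sumr_ge0 // => i _; rewrite mulr_ge0 ?ler0n.
Qed.

Lemma stage2_pos : exists z, stage2 m z != 0.
Proof.
have [S S0 Sm] := flag_weight_exists m_ge0 m_pos.
have [w wS] := finset.set0Pn _ S0.
exists (if (#|S| <= 2)%N then V w else cc (vertices S)).
rewrite gt_eqF // /stage2 (bigD1 S) //= ltr_wpDr //.
  apply: sumr_ge0 => S' _; rewrite mulr_ge0 ?flag_weight_ge0 //.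
  by case: ifP => _; rewrite ?ler0n // sumr_ge0 // => i _; rewrite ler0n.
rewrite mulr_gt0 //; case: (#|S| <= 2)%N; last by rewrite eqxx ltr01.
rewrite (bigD1 w) //= eqxx ltr_wpDr // sumr_ge0 // => i _; exact: ler0n.
Qed.

Lemma stage3_pos : exists z, stage3 m z != 0.
Proof.
have [S S0 Sm] := flag_weight_exists m_ge0 m_pos.
exists (cc (vertices S)).
rewrite gt_eqF // /stage3 (bigD1 S) //= eqxx mulr1 ltr_wpDr //.
by apply: sumr_ge0 => S' _; rewrite mulr_ge0 ?flag_weight_ge0 // ler0n.
Qed.

Lemma vertices_sub S : flag_weight S m != 0 -> vertices S `<=` s0.
Proof.
move=> /(flag_weight_neq0 m_ge0)[Sm _] _ [w wS <-].
by apply: Vs0; exact: Sm.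
Qed.

Lemma vertices_neq0 S : S != finset.set0 -> vertices S !=set0.
Proof. by move=> /finset.set0Pn[w wS]; exists (V w), w. Qed.

Lemma vertices_L S : S != finset.set0 -> flag_weight S m != 0 -> L (vertices S).
Proof.
by move=> S0 Sm; apply: (VR_sub Ls0); [exact: vertices_sub|exact: vertices_neq0].
Qed.

Lemma vertices_mono S S' : S \subset S' -> vertices S `<=` vertices S'.
Proof. by move=> /fintype.subsetP SS' _ [w wS <-]; exists w => //; exact: SS'. Qed.

(** Two image vertices on each side would come from four distinct indices of positive weight, which
    [m_four] forbids. *)
Lemma vertices_center S : S != finset.set0 -> flag_weight S m != 0 ->
  center_spec d X Y r (vertices S) (cc (vertices S)).
Proof.
move=> S0 Sm; have LS := vertices_L S0 Sm; apply: ccP => // bS.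
apply: (small_one_sided XYT LS bS).
move=> [x [x' [y [y' [[Sx Sx' Sy Sy'] xx' yy' [Xx Xx'] [Yy Yy']]]]]].
have XY u v : vertices S u -> X u -> Y v -> u <> v.
  by move=> Su Xu Yv uv; apply: (notA_bad LS bS Su); split; rewrite // uv.
have [xy xy' x'y x'y'] := And4 (XY _ _ Sx Xx Yy) (XY _ _ Sx Xx Yy')
  (XY _ _ Sx' Xx' Yy) (XY _ _ Sx' Xx' Yy').
have [Spos _] := flag_weight_neq0 m_ge0 Sm.
case: Sx Sx' Sy Sy' => [w1 w1S E1] [w2 w2S E2] [w3 w3S E3] [w4 w4S E4].
apply: (m_four (w1 := w1) (w2 := w2) (w3 := w3) (w4 := w4)); [|exact: Spos..].
rewrite /= !inE !negb_or andbT.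
have neq u v a b : V u = a -> V v = b -> a <> b -> u != v.
  by move=> <- <- H; apply/eqP => uv; apply: H; rewrite uv.
by rewrite (neq _ _ _ _ E1 E2) // (neq _ _ _ _ E1 E3) // (neq _ _ _ _ E1 E4) //
  (neq _ _ _ _ E2 E3) // (neq _ _ _ _ E2 E4) // (neq _ _ _ _ E3 E4).
Qed.

Lemma centers_close S S' :
  S != finset.set0 -> flag_weight S m != 0 ->
  S' != finset.set0 -> flag_weight S' m != 0 ->
  close (cc (vertices S)) (cc (vertices S')).
Proof.
move=> S0 Sm S'0 S'm; have LS := vertices_L S0 Sm; have LS' := vertices_L S'0 S'm.
have cS := vertices_center S0 Sm; have cS' := vertices_center S'0 S'm.
have [SS'|S'S] := flag_weight_chain m_ge0 Sm S'm.
  exact: (center_close dP XYT r_ge0 ssa LS LS' (vertices_mono SS') cS cS').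
by apply: (close_sym dP);
  exact: (center_close dP XYT r_ge0 ssa LS' LS (vertices_mono S'S) cS' cS).
Qed.

(** A single vertex lies in X or in Y, so it spans a good simplex and the center must belong to
    it. *)
Lemma singleton_center w : flag_weight [set w]%SET m != 0 -> cc (vertices [set w]%SET) = V w.
Proof.
move=> wm; have w0 : [set w]%SET != finset.set0 by apply/finset.set0Pn; exists w; rewrite inE.
have Lw := vertices_L w0 wm.
have vE : vertices [set w]%SET `<=` [set V w] by move=> _ [w' /= + <-]; rewrite inE => /eqP ->.
have [_ gw _ _] := vertices_center w0 wm.
apply: (vE); apply: gw; split => //.
have : [set: Z] (V w) by []; rewrite -XYT => -[Xw|Yw]; [apply: Or31|apply: Or32];
  by move=> _ /vE ->.
Qed.

Lemma stage1_sub : supp (stage1 m) `<=` s0.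
Proof. by move=> z /stage1_neq0[w mw ->]; exact: Vs0. Qed.

(** At most three weights are positive, so a flag set with three elements contains every index of
    positive weight, and its center is close to all vertices that occur. *)
Lemma stage12_close x y : (supp (stage1 m) `|` supp (stage2 m)) x ->
  (supp (stage1 m) `|` supp (stage2 m)) y -> close x y.
Proof.
have U z : (supp (stage1 m) `|` supp (stage2 m)) z ->
    (exists2 w, 0 < m w & z = V w) \/
    exists S, [/\ S != finset.set0, flag_weight S m != 0, (2 < #|S|)%N &
                  z = cc (vertices S)].
  move=> [/stage1_neq0|/stage2_neq0[S [S0 Sm]]]; first by left.
  case: ifP => [_ [w wS ->]|S2 zE].
    by left; exists w => //; case: (flag_weight_neq0 m_ge0 Sm) => + _; apply.
  by right; exists S; split => //; rewrite ltnNge S2.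
have Vc w S : 0 < m w -> S != finset.set0 -> flag_weight S m != 0 -> (2 < #|S|)%N ->
    close (cc (vertices S)) (V w).
  move=> mw S0 Sm S3; have [cS _ _ _] := vertices_center S0 Sm; apply: cS.
  exists w => //=; apply: contraT => wS.
  have [Spos _] := flag_weight_neq0 m_ge0 Sm.
  have [x1 [x2 [x3 [[x1S x2S x3S] [n12 n23 n31]]]]] := card_gt2P S3.
  exfalso; apply: (m_four (w1 := w) (w2 := x1) (w3 := x2) (w4 := x3));
    [|by []|exact: Spos..].
  have nw u : u \in S -> w != u by move=> uS; apply: contraNneq wS => ->.
  by rewrite /= !inE !negb_or !nw //= n12 n23 eq_sym n31.
move=> /U[[w mw ->]|[S [S0 Sm S2 ->]]] /U[[w' mw' ->]|[S' [S'0 S'm S'2 ->]]].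
- by apply: (VR_close Ls0); exact: Vs0.
- by apply: (close_sym dP); exact: Vc.
- exact: Vc.
- exact: centers_close.
Qed.

(** If a vertex of a flag set [S] with at most two elements is missing from [S'], then [S'] is a
    proper nonempty subset of [S], hence a singleton, and its center is its own vertex. *)
Lemma stage23_close x y : (supp (stage2 m) `|` supp (stage3 m)) x ->
  (supp (stage2 m) `|` supp (stage3 m)) y -> close x y.
Proof.
have U z : (supp (stage2 m) `|` supp (stage3 m)) z ->
    (exists S w, [/\ w \in S, flag_weight S m != 0, (#|S| <= 2)%N & z = V w]) \/
    exists S, [/\ S != finset.set0, flag_weight S m != 0 & z = cc (vertices S)].
  move=> [/stage2_neq0[S [S0 Sm]]|/stage3_neq0[S [S0 Sm ->]]]; last by right; exists S.
  case: ifP => [S2 [w wS ->]|S2 zE]; last by right; exists S.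
  by left; exists S, w.
have pos w S : w \in S -> flag_weight S m != 0 -> 0 < m w.
  by move=> wS /(flag_weight_neq0 m_ge0)[Sp _]; exact: Sp.
have Vc w S S' : w \in S -> flag_weight S m != 0 -> (#|S| <= 2)%N ->
    S' != finset.set0 -> flag_weight S' m != 0 -> close (cc (vertices S')) (V w).
  move=> wS Sm S2 S'0 S'm; have [cS' _ _ _] := vertices_center S'0 S'm.
  have [wS'|wS'] := boolP (w \in S'); first by apply: cS'; exists w.
  have [SS'|S'S] := flag_weight_chain m_ge0 Sm S'm.
    by rewrite (fintype.subsetP SS' _ wS) in wS'.
  have : (#|S'| < #|S|)%N.
    by apply: fintype.proper_card; apply/fintype.properP; split => //; exists w.
  move=> /leq_trans/(_ S2); rewrite ltnS leq_eqVlt ltnS leqn0 cards_eq0 (negbTE S'0) orbF.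
  move=> /cards1P[w' S'E]; rewrite S'E singleton_center -?S'E //.
  apply: (VR_close Ls0); apply: Vs0; last exact: (pos _ _ wS).
  by apply: (pos _ S') => //; rewrite S'E inE.
move=> /U[[S [w [wS Sm S2 ->]]]|[S [S0 Sm ->]]] /U[[S' [w' [wS' S'm S'2 ->]]]|[S' [S'0 S'm ->]]].
- by apply: (VR_close Ls0); apply: Vs0; [exact: (pos _ _ wS)|exact: (pos _ _ wS')].
- by apply: (close_sym dP); exact: (Vc w S).
- exact: (Vc w' S').
- exact: centers_close.
Qed.

(** All faces of a simplex of K are good, so their centers are among their vertices and nothing
    leaves [s0]. *)
Lemma stages_sub : K s0 -> supp (stage2 m) `|` supp (stage3 m) `<=` s0.
Proof.
move=> Ks0; have cs0 S : S != finset.set0 -> flag_weight S m != 0 -> s0 (cc (vertices S)).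
  move=> S0 Sm; apply: (vertices_sub Sm).
  have [_ gS _ _] := vertices_center S0 Sm; apply: gS; apply: K_good.
  by apply: (K_sub Ks0); [exact: vertices_sub|exact: vertices_neq0].
move=> z [/stage2_neq0[S [S0 Sm]]|/stage3_neq0[S [S0 Sm ->]]]; last exact: cs0.
case: ifP => [_ [w wS ->]|_ ->]; last exact: cs0.
by apply: (vertices_sub Sm); exists w.
Qed.

Lemma stage3_side : supp (stage3 m) `<=` X \/ supp (stage3 m) `<=` Y.
Proof.
pose F := [set s | exists S, [/\ S != finset.set0, flag_weight S m != 0 & s = vertices S]].
have [|||H] := @chain_centers R Z d X Y r F cc.
- by move=> _ [S [S0 Sm ->]]; exact: vertices_center.
- move=> _ _ [S [S0 Sm ->]] [S' [S'0 S'm ->]].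
  by have [?|?] := flag_weight_chain m_ge0 Sm S'm; [left|right]; exact: vertices_mono.
- by move=> H; left => z /stage3_neq0[S [S0 Sm ->]]; apply: H; exists S.
- by right => z /stage3_neq0[S [S0 Sm ->]]; apply: H; exists S.
Qed.

End Stages.
End Push.

(** * Assembling the stages into one homotopy *)

Lemma stage1_continuous (R : realType) (Z : choiceType) (W : finType) (V : W -> Z)
  (T : topologicalType) (mu : W -> T -> R) z :
  (forall w, continuous (mu w)) ->
  continuous (fun p => stage1 V (fun w => mu w p) z).
Proof.
move=> cmu; apply: cont_sum => w; apply: contM => //; exact: cst_continuous.
Qed.

Lemma stage2_continuous (R : realType) (Z : choiceType) (W : finType) (V : W -> Z)
  (cc : set Z -> Z) (T : topologicalType) (mu : W -> T -> R) z :
  (forall w, continuous (mu w)) ->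
  continuous (fun p => stage2 V cc (fun w => mu w p) z).
Proof.
move=> cmu; apply: cont_sum => S; apply: contM; last exact: cst_continuous.
exact: flag_weight_continuous.
Qed.

Lemma stage3_continuous (R : realType) (Z : choiceType) (W : finType) (V : W -> Z)
  (cc : set Z -> Z) (T : topologicalType) (mu : W -> T -> R) z :
  (forall w, continuous (mu w)) ->
  continuous (fun p => stage3 V cc (fun w => mu w p) z).
Proof.
move=> cmu; apply: cont_sum => S; apply: contM; last exact: cst_continuous.
exact: flag_weight_continuous.
Qed.

(** Piecewise linear nodal functions for the times 0, 1/3, 2/3 and 1, which are the times of [g] and
    of the three stages. *)
Definition hat (R : realType) (i : nat) (u : R) : R :=
  Num.max 0 (1 - `|3 * clamp u - i%:R|).

Lemma hat_ge0 (R : realType) i (u : R) : 0 <= hat i u.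
Proof. by rewrite /hat le_max lexx. Qed.

Lemma hat_continuous (R : realType) (T : topologicalType) i (f : T -> R) :
  continuous f -> continuous (fun t => hat i (f t)).
Proof.
move=> cf; apply: cont_max; first exact: cst_continuous.
apply: contB; first exact: cst_continuous.
apply: cont_norm; apply: contB; last exact: cst_continuous.
by apply: contM; [exact: cst_continuous|exact: continuous_clamp].
Qed.

Lemma hat_eq0 (R : realType) i (u : R) : 1 <= `|3 * clamp u - i%:R| -> hat i u = 0.
Proof. by move=> H; rewrite /hat max_l // subr_le0. Qed.

(** At each time only two consecutive nodal functions can be nonzero, so only supports of
    consecutive stages have to span a common simplex. *)
Lemma hat_cases (R : realType) (u : R) :
  [\/ hat 2 u = 0 /\ hat 3 u = 0 /\ (0 < hat 0 u \/ 0 < hat 1 u),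
      hat 0 u = 0 /\ hat 3 u = 0 /\ (0 < hat 1 u \/ 0 < hat 2 u) |
      hat 0 u = 0 /\ hat 1 u = 0 /\ (0 < hat 2 u \/ 0 < hat 3 u)].
Proof.
have /unitIP[c0 c1] := clamp_in u.
have pos i : `|3 * clamp u - i%:R| < 1 -> 0 < hat i u.
  by move=> H; rewrite /hat lt_max ltxx /= subr_gt0.
have big1 i : 1 <= 3 * clamp u - i%:R -> hat i u = 0.
  by move=> H; apply: hat_eq0; apply: le_trans H (ler_norm _).
have big2 i : 1 <= i%:R - 3 * clamp u -> hat i u = 0.
  by move=> H; apply: hat_eq0; rewrite distrC; apply: le_trans H (ler_norm _).
have [h1|h1] := leP (3 * clamp u) 1.
  apply: Or31; split; [by apply: big2; lra|split; first by apply: big2; lra].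
  have [h|h] := ltP (3 * clamp u) 1.
    by left; apply: pos; rewrite ltr_norml; apply/andP; split; lra.
  by right; apply: pos; rewrite ltr_norml; apply/andP; split; lra.
have [h2|h2] := leP (3 * clamp u) 2.
  apply: Or32; split; [by apply: big1; lra|split; first by apply: big2; lra].
  have [h|h] := ltP (3 * clamp u) 2.
    by left; apply: pos; rewrite ltr_norml; apply/andP; split; lra.
  by right; apply: pos; rewrite ltr_norml; apply/andP; split; lra.
apply: Or33; split; [by apply: big1; lra|split; first by apply: big1; lra].
have [h|h] := ltP (3 * clamp u) 3.
  by left; apply: pos; rewrite ltr_norml; apply/andP; split; lra.
by right; apply: pos; rewrite ltr_norml; apply/andP; split; lra.
Qed.

Lemma hat_at0 (R : realType) : [/\ hat 0 (0 : R) = 1, hat 1 (0 : R) = 0,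
  hat 2 (0 : R) = 0 & hat 3 (0 : R) = 0].
Proof.
have c0 : clamp (0 : R) = 0 by exact: clamp_le0.
split; first by rewrite /hat c0 mulr0 subrr normr0 subr0 max_r.
all: by apply: hat_eq0; rewrite c0 mulr0 sub0r normrN ger0_norm ?ler0n // ler1n.
Qed.

Lemma hat_at1 (R : realType) : [/\ hat 0 (1 : R) = 0, hat 1 (1 : R) = 0,
  hat 2 (1 : R) = 0 & hat 3 (1 : R) = 1].
Proof.
have c1 : clamp (1 : R) = 1 by exact: clamp_ge1.
have big i : (1 : R) <= 3 - i%:R -> hat i (1 : R) = 0.
  by move=> H; apply: hat_eq0; rewrite c1 mulr1; apply: le_trans H (ler_norm _).
split; [by apply: big; lra..|].
by rewrite /hat c1 mulr1 subrr normr0 subr0 max_r.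
Qed.

Section PushMap.
Variables (R : realType) (Z : choiceType) (d : Z -> Z -> \bar R).
Variables (X Y : set Z) (r : R).
Hypothesis dP : pseudometric d.
Hypothesis XYT : X `|` Y = setT.
Hypothesis finA : finite_set (X `&` Y).
Hypothesis r_ge0 : 0 <= r.
Hypothesis gluing : metric_gluing d X Y.
Hypothesis ssa : strong_simplex_assumption d r X Y.

Local Notation L := (VR d r setT).
Local Notation K := (VR d r X `|` VR d r Y).

(* The homotopy runs linearly from g to a simplicial approximation (stage1),
   then to its coning-off of the triangles (stage2), then to its barycentric
   subdivision (stage3), in which every simplex vS is sent to its center. *)
Lemma push_into_K (g : R * R -> geom R L) : continuous g ->
  exists (F : {fset Z}) (h : R * (R * R) -> geom R L),
  [/\ continuous h, forall p v, v \notin F -> sval (h p) v = 0,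
      forall p, unitI2 R p -> h (0, p) = g p,
      forall p, K (supp (sval (h (1, p)))) &
      forall u p, unitI2 R p -> K (supp (sval (g p))) ->
        K (supp (sval (h (u, p))))].
Proof.
move=> gc.
have L0 s : L s -> finite_set s /\ s !=set0 by case.
have [F0 F0P] := compact_support (0, 0) L0 gc (@compact_unitI2 R).
have L0' s : L s -> s !=set0 by case.
have [e e0 eP] := lebesgue_number L0' gc.
have [W [c [mu [[cI muc mu0 mupos] [muc_close mu4]]]]] := hat_functions e0.
have /choice[V VP] : forall w, exists v, forall p,
    `|p.1 - (c w).1| < e -> `|p.2 - (c w).2| < e -> sval (g p) v != 0.
  by move=> w; exact: eP.
have [z0 _] := L0' _ (geom_supp (g (0, 0))).
have [cc ccP] := center_exists dP XYT finA r_ge0 gluing ssa z0.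
(* Evaluating at the clamped parameter makes the facts known on the square hold on the whole
   plane. *)
pose m p w := mu w (clamp2 p).
pose t p z := sval (g (clamp2 p)) z.
pose st1 p := stage1 V (m p).
pose st2 p := stage2 V cc (m p).
pose st3 p := stage3 V cc (m p).
have m0 p w : 0 <= m p w by exact: mu0.
have mpos p : exists w, 0 < m p w by apply: mupos; exact: clamp2_in.
have m4 p w1 w2 w3 w4 : uniq [:: w1; w2; w3; w4] ->
    0 < m p w1 -> 0 < m p w2 -> 0 < m p w3 -> 0 < m p w4 -> False.
  exact: mu4.
have Lt p : L (supp (t p)) by exact: geom_supp.
(* This is the simplicial approximation property: a node active at [p] goes to a vertex of the
   simplex that carries [t p]. *)
have Vt p w : 0 < m p w -> supp (t p) (V w).
  by move=> /muc_close[? ?]; exact: VP.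
pose n (q : R * (R * R)) z := hat 0 q.1 * t q.2 z + hat 1 q.1 * st1 q.2 z +
  hat 2 q.1 * st2 q.2 z + hat 3 q.1 * st3 q.2 z.
have t_ge0 p z : 0 <= t p z by exact: geom_ge0.
have st1_ge0 p z : 0 <= st1 p z by exact: stage1_ge0.
have st2_ge0 p z : 0 <= st2 p z by exact: stage2_ge0.
have st3_ge0 p z : 0 <= st3 p z by exact: stage3_ge0.
have n_ge0 q z : 0 <= n q z.
  by rewrite /n !addr_ge0 // mulr_ge0 // hat_ge0.
have n_cont z : continuous (fun q => n q z).
  have ct : continuous (fun q : R * (R * R) => t q.2 z).
    have c2 : continuous (fun q : R * (R * R) => clamp2 q.2).
      by apply: (cont_comp _ (@continuous_clamp2 R)) => q; exact: cvg_snd.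
    exact: (cont_comp (cont_comp c2 gc) (continuous_coord (v := z))).
  have cm w : continuous (fun q : R * (R * R) => m q.2 w).
    apply: (cont_comp _ (muc w)).
    by apply: (cont_comp _ (@continuous_clamp2 R)) => q; exact: cvg_snd.
  have ch i : continuous (fun q : R * (R * R) => hat i q.1).
    by apply: hat_continuous => q; exact: cvg_fst.
  apply: contD; last first.
    by apply: contM; [exact: ch|exact: (stage3_continuous (mu := fun w q => m q.2 w))].
  apply: contD; last first.
    by apply: contM; [exact: ch|exact: (stage2_continuous (mu := fun w q => m q.2 w))].
  apply: contD; last first.
    by apply: contM; [exact: ch|exact: (stage1_continuous (mu := fun w q => m q.2 w))].
  by apply: contM; [exact: ch|exact: ct].
have n_supp (B : set Z) q : [\/ hat 2 q.1 = 0 /\ hat 3 q.1 = 0 /\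
    supp (t q.2) `|` supp (st1 q.2) `<=` B,
    hat 0 q.1 = 0 /\ hat 3 q.1 = 0 /\ supp (st1 q.2) `|` supp (st2 q.2) `<=` B |
    hat 0 q.1 = 0 /\ hat 1 q.1 = 0 /\ supp (st2 q.2) `|` supp (st3 q.2) `<=` B] ->
    supp (n q) `<=` B.
  have nz (a x b y : R) : a * x + b * y != 0 -> x != 0 \/ y != 0.
    have [->|x0] := eqVneq x 0; last by left.
    by have [->|y0] := eqVneq y 0; [rewrite !mulr0 addr0 eqxx|right].
  by move=> [[h [h' sB]]|[h [h' sB]]|[h [h' sB]]] z;
    rewrite /supp /= /n h h' !(mul0r, add0r, addr0) => /nz[Hz|Hz];
    apply: (sB z); rewrite /supp /=; tauto.
have n_cov q : supp (n q) `<=` supp (t q.2) `|` supp (st1 q.2) `|`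
    (supp (st2 q.2) `|` supp (st3 q.2)).
  apply: n_supp; have [[h [h' _]]|[h [h' _]]|[h [h' _]]] := hat_cases q.1.
  - by apply: Or31; split => //; split => // z Hz; left.
  - by apply: Or32; split => //; split => // z [Hz|Hz]; [left; right|right; left].
  - by apply: Or33; split => //; split => // z Hz; right.
(* Besides vertices in the supports of [g], only centers of the finitely many subsets of [W]
   occur. *)
have F1P : exists F1 : {fset Z}, forall q, supp (n q) `<=` [set` F1].
  exists (F0 `|` [fset cc (vertices V S) | S in {: {set W}}])%fset => q z.
  have tF x : supp (t q.2) x -> x \in F0.
    rewrite /supp /=; apply: contraNT => xF; apply/eqP; apply: F0P => //.
    exact: clamp2_in.
  have ccF S : cc (vertices V S) \in [fset cc (vertices V S) | S in {: {set W}}]%fset.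
    by apply/imfsetP; exists S.
  move/n_cov => /= H; rewrite inE; apply/orP.
  case: H => [[/tF|/(stage1_sub (m0 q.2) (Vt q.2))/tF]|[]]; [by left|by left| |].
    move=> /stage2_neq0[S [S0 Sm]]; case: ifP => _; last by move=> ->; right.
    case=> w wS ->; left; apply: tF; apply: Vt.
    by have [+ _] := flag_weight_neq0 (m0 q.2) Sm; apply.
  by move=> /stage3_neq0[S [S0 Sm ->]]; right.
have n_pos q : supp (n q) !=set0.
  have tp : exists z, t q.2 z != 0 by have [z] := L0' _ (Lt q.2); exists z.
  have P1 := stage1_pos V (m0 q.2) (mpos q.2).
  have P2 := stage2_pos V cc (m0 q.2) (mpos q.2).
  have P3 := stage3_pos V cc (m0 q.2) (mpos q.2).
  have pos (x : R) : 0 <= x -> x != 0 -> 0 < x by move=> ? ?; rewrite lt_neqAle eq_sym; apply/andP.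
  have [b0 b1 b2 b3] := And4 (hat_ge0 0 q.1) (hat_ge0 1 q.1) (hat_ge0 2 q.1) (hat_ge0 3 q.1).
  have ge1 z : hat 0 q.1 * t q.2 z <= n q z.
    by rewrite /n -!addrA lerDl !addr_ge0 // mulr_ge0.
  have ge2 z : hat 1 q.1 * st1 q.2 z <= n q z.
    by rewrite /n -!addrA addrCA lerDl !addr_ge0 // mulr_ge0.
  have ge3 z : hat 2 q.1 * st2 q.2 z <= n q z.
    by rewrite /n -addrA addrCA lerDl !addr_ge0 // mulr_ge0.
  have ge4 z : hat 3 q.1 * st3 q.2 z <= n q z.
    by rewrite /n lerDr !addr_ge0 // mulr_ge0.
  have fin (h : R) (f : Z -> R) : 0 < h -> (forall z, 0 <= f z) ->
      (forall z, h * f z <= n q z) -> (exists z, f z != 0) -> supp (n q) !=set0.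
    move=> h0 f0 hf [z fz]; exists z; rewrite /supp /= gt_eqF //.
    by apply: lt_le_trans (hf z); rewrite mulr_gt0 // pos.
  have [[_ [_ [h|h]]]|[_ [_ [h|h]]]|[_ [_ [h|h]]]] := hat_cases q.1.
  - exact: (fin _ _ h (t_ge0 q.2) ge1 tp).
  - exact: (fin _ _ h (st1_ge0 q.2) ge2 P1).
  - exact: (fin _ _ h (st1_ge0 q.2) ge2 P1).
  - exact: (fin _ _ h (st2_ge0 q.2) ge3 P2).
  - exact: (fin _ _ h (st2_ge0 q.2) ge3 P2).
  - exact: (fin _ _ h (st3_ge0 q.2) ge4 P3).
have n_L q : L (supp (n q)).
  apply: VRI => //.
    by have [F1 F1n] := F1P; apply: sub_finite_set (F1n q) _; exact: finite_fset.
  move=> x y; have [[h [h' _]]|[h [h' _]]|[h [h' _]]] := hat_cases q.1.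
  - have sub : supp (n q) `<=` supp (t q.2).
      apply: n_supp; apply: Or31; split => //; split => // z [//|].
      exact: (stage1_sub (m0 q.2) (Vt q.2)).
    by move=> /sub nx /sub ny; exact: VR_close (Lt q.2) nx ny.
  - have sub : supp (n q) `<=` supp (st1 q.2) `|` supp (st2 q.2).
      by apply: n_supp; apply: Or32; split => //; split.
    move=> /sub nx /sub ny.
    exact: (stage12_close dP XYT r_ge0 ssa ccP (m0 q.2) (@m4 q.2) (Lt q.2) (@Vt q.2) nx ny).
  - have sub : supp (n q) `<=` supp (st2 q.2) `|` supp (st3 q.2).
      by apply: n_supp; apply: Or33; split => //; split.
    move=> /sub nx /sub ny.
    exact: (stage23_close dP XYT r_ge0 ssa ccP (m0 q.2) (@m4 q.2) (Lt q.2) (@Vt q.2) nx ny).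
have n_K q : K (supp (t q.2)) -> K (supp (n q)).
  move=> Kt; apply: (K_sub Kt) => // z /n_cov[[//|]|].
    exact: (stage1_sub (m0 q.2) (Vt q.2)).
  exact: (stages_sub XYT ccP (m0 q.2) (@m4 q.2) (Lt q.2) (@Vt q.2) Kt).
(* Only [stage3] survives at time 1: [n_L] makes its support a simplex of L, and [stage3_side] puts
   that simplex on one side. *)
have n_K1 p : K (supp (n (1, p))).
  have [h0 h1 h2 h3] := hat_at1 R.
  have sub : supp (n (1, p)) `<=` supp (st3 p).
    by move=> z; rewrite /supp /= /n /= h0 h1 h2 h3 !(mul0r, add0r) mul1r.
  have [fn n0 _ nc] := n_L (1, p).
  have [sX|sY] := stage3_side XYT ccP (m0 p) (@m4 p) (Lt p) (@Vt p).
    by left; split => //; exact: subset_trans sX.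
  by right; split => //; exact: subset_trans sY.
have [F1 F1n] := F1P.
have nF q v : v \notin F1 -> n q v = 0.
  by move=> vF; apply/eqP; apply: contraNT vF => /F1n.
have [h hc hE] := conic_map L0' n_ge0 n_cont nF n_L.
have hsupp q : supp (sval (h q)) = supp (n q).
  apply/seteqP; split=> z; rewrite /supp /= hE mulf_eq0 negb_or; first by case/andP.
  move=> nz; rewrite nz invr_eq0 gt_eqF // (big_fsetD1 z) ?(F1n q) //= ltr_wpDr ?sumr_ge0 //.
  by rewrite lt_neqAle eq_sym nz n_ge0.
exists F1, h; split => //.
- by move=> q v vF; rewrite hE nF // mul0r.
- move=> p pI; have [h0 h1 h2 h3] := hat_at0 R.
  have nE z : n (0, p) z = sval (g p) z.
    by rewrite /n /= h0 h1 h2 h3 !mul0r !addr0 mul1r /t clamp2_id.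
  apply: geom_eq => z; rewrite hE nE.
  have -> : \sum_(w <- F1) n (0, p) w = 1; last by rewrite divr1.
  under eq_bigr do rewrite nE.
  case: (g p) nE => f [f0 fL /= f1] nE; rewrite -f1 (fsbig_fwiden F1) //.
    by move=> w /=; rewrite /supp /= -nE => /F1n.
  by move=> w [/= wF] /negP; rewrite negbK => /eqP ->.
- by move=> p; rewrite hsupp.
- move=> u p pI Kp; rewrite hsupp; apply: n_K => /=.
  by rewrite /t clamp2_id.
Qed.

End PushMap.

(** * From free to relative homotopies *)

Section Square.
Variable R : realType.
Implicit Types (p : R * R) (l s : R).

Definition width p : R := Num.max `|2 * p.1 - 1| `|2 * p.2 - 1|.

Definition scale l p : R * R := (1/2 + (p.1 - 1/2) * l, 1/2 + (p.2 - 1/2) * l).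

Lemma scale1 p : scale 1 p = p.
Proof. by case: p => x y; rewrite /scale /= !mulr1 ![1/2 + _]addrC !subrK. Qed.

Lemma scaleA l l' p : scale l (scale l' p) = scale (l * l') p.
Proof. by rewrite /scale /=; congr pair; field. Qed.

(** On a middle line of the square, a point outside the core is thrown by the projection from the
    center to one of the two ends of that line. *)
Lemma radial_projection (x : R) : 1/2 < `|2 * x - 1| ->
  1/2 + (x - 1/2) / `|2 * x - 1| = 0 \/ 1/2 + (x - 1/2) / `|2 * x - 1| = 1.
Proof.
by have [h|h] := ger0P (2 * x - 1) => w; [right|left]; field; lra.
Qed.

Lemma width_scale l p : 0 <= l -> width (scale l p) = l * width p.
Proof.
move=> l0; rewrite /width maxr_pMr // /scale /=.
have E (x : R) : 2 * (1/2 + (x - 1/2) * l) - 1 = l * (2 * x - 1) by field.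
by rewrite !E !normrM ger0_norm.
Qed.

Lemma width_le1 p : unitI2 R p <-> width p <= 1.
Proof.
rewrite /width ge_max !ler_norml; split.
  by move=> [/unitIP[a b] /unitIP[c e]]; apply/andP; split; apply/andP; split; lra.
by move=> /andP[/andP[a b] /andP[c e]]; split; apply/unitIP; split; lra.
Qed.

Lemma boundary_width p : boundaryI2 R p <-> width p = 1.
Proof.
split.
  move=> [pI pb]; apply/eqP; rewrite eq_le (width_le1 p).1 //= /width le_max.
  have n1 : 1 <= `|-1 : R| by rewrite normrN1.
  case: pb => [|[|[|]]] ->; rewrite ?mulr0 ?mulr1 ?sub0r ?n1 ?orbT //.
    by rewrite (_ : 2 - 1 = 1) ?normr1 ?lexx //; ring.
  by rewrite (_ : 2 - 1 = 1) ?normr1 ?lexx ?orbT //; ring.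
move=> w1; split; first by apply/width_le1; rewrite w1.
have H (x : R) : `|2 * x - 1| = 1 -> x = 0 \/ x = 1.
  have [h|h] := ger0P (2 * x - 1) => E; [right|left]; lra.
move: w1; rewrite /width /Num.max; case: ifP => _ /H; tauto.
Qed.

Lemma scale_in l p : 0 <= l -> l * width p <= 1 -> unitI2 R (scale l p).
Proof. by move=> l0 lw; apply/width_le1; rewrite width_scale. Qed.

Lemma width_continuous : continuous width.
Proof.
have c1 : continuous (fun p => p.1 : R) by move=> ?; exact: cvg_fst.
have c2 : continuous (fun p => p.2 : R) by move=> ?; exact: cvg_snd.
apply: cont_max; apply: cont_norm; apply: contB; try exact: cst_continuous;
  by apply: contM => //; exact: cst_continuous.
Qed.

Lemma scale_continuous (T : topologicalType) (l : T -> R) (q : T -> R * R) :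
  continuous l -> continuous q -> continuous (fun t => scale (l t) (q t)).
Proof.
move=> cl cq; apply: cont_pair.
  apply: contD; first exact: cst_continuous.
  apply: contM => //; apply: contB; last exact: cst_continuous.
  exact: cont_fst.
apply: contD; first exact: cst_continuous.
apply: contM => //; apply: contB; last exact: cst_continuous.
exact: cont_snd.
Qed.

Lemma boundary_clamp_scale l p : boundaryI2 R p -> 1 <= l ->
  boundaryI2 R (clamp2 (scale l p)).
Proof.
move=> [pI pb] l1; split; first exact: clamp2_in.
by case: pb => [|[|[|]]] E; rewrite /clamp2 /scale /= E;
  [left; apply: clamp_le0|right; left; apply: clamp_ge1|
   right; right; left; apply: clamp_le0|right; right; right; apply: clamp_ge1]; lra.
Qed.

End Square.

(** * The box over the square *)

Section Box.
Variables (R : realType) (Z : choiceType) (K L : set (set Z)).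

(* The square is divided into a half-size core, on which the pushing homotopy
   runs completely, and a collar, on which it is slowed down to the constant
   homotopy on the boundary while the map is stretched radially. *)
Lemma collar_homotopy (F : R * R -> geom R L) (S : {fset Z})
  (h : R * (R * R) -> geom R L) :
  continuous h -> (forall p v, v \notin S -> sval (h p) v = 0) ->
  (forall p, unitI2 R p -> h (0, p) = F p) ->
  (forall p, K (supp (sval (h (1, p))))) ->
  (forall u p, unitI2 R p -> K (supp (sval (F p))) -> K (supp (sval (h (u, p))))) ->
  exists B : R * (R * R) -> geom R L,
  [/\ continuous B, forall p v, v \notin S -> sval (B p) v = 0 &
      forall p, unitI2 R p -> B (1, p) = F (scale (1/2) p)] /\
  (forall s p, unitI R s -> boundaryI2 R p -> B (s, p) = F (scale (1 - s/2) p)) /\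
  (forall p, unitI2 R p ->
     width p <= 1/2 \/ K (supp (sval (F (scale (width p)^-1 p)))) ->
     K (supp (sval (B (0, p))))).
Proof.
move=> hc hS h0 h1 hK.
pose M (p : R * R) : R := Num.max (width p) (1/2).
have M0 p : 0 < M p by rewrite /M lt_max; apply/orP; right; lra.
have wM p : width p <= M p by rewrite /M le_max lexx.
have w0 (p : R * R) : 0 <= width p by rewrite /width le_max normr_ge0.
(* At height 0 the time [tau] is 1 on the core and drops to 0 at the boundary, while [lam] doubles
   the core and projects the collar onto the boundary. At height 1, [tau] is 0 and [lam] is 1/2,
   which leaves the core of [F]. *)
pose tau (q : R * (R * R)) := (1 - q.1) * Num.min 1 (2 * (1 - width q.2)).
pose lam (q : R * (R * R)) := (1 - q.1) * (M q.2)^-1 + q.1 / 2.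
pose B q := h (tau q, scale (lam q) q.2).
have cw : continuous (fun q : R * (R * R) => width q.2).
  by apply: (cont_comp _ (@width_continuous R)) => q; exact: cvg_snd.
have c1 : continuous (fun q : R * (R * R) => 1 - q.1).
  by apply: contB; [exact: cst_continuous|move=> ?; exact: cvg_fst].
have ctau : continuous tau.
  apply: contM => //; apply: cont_min; first exact: cst_continuous.
  by apply: contM; [exact: cst_continuous|apply: contB => //; exact: cst_continuous].
have clam : continuous lam.
  apply: contD; last by apply: contM; [move=> ?; exact: cvg_fst|exact: cst_continuous].
  apply: contM => //; apply: contV; last by move=> q; rewrite gt_eqF.
  by apply: cont_max => //; exact: cst_continuous.
exists B; split; last split.
- split.
  + apply: (cont_comp _ hc); apply: cont_pair => //.
    by apply: scale_continuous => // q; exact: cvg_snd.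
  + by move=> q v; exact: hS.
  + move=> p /width_le1 pI; rewrite /B /tau /lam /= subrr !mul0r add0r h0 //.
    by apply: scale_in; [lra|have := w0 p; lra].
- move=> s p /unitIP[s0 s1] /boundary_width wp.
  have Mp : M p = 1 by rewrite /M wp max_l //; lra.
  rewrite /B /tau /lam /= Mp wp subrr mulr0 min_r ?ler01 // mulr0 invr1 mulr1.
  have -> : 1 - s + s / 2 = 1 - s / 2 by field.
  by rewrite h0 //; apply: scale_in; rewrite ?wp; lra.
- move=> p /width_le1 wp; rewrite /B /tau /lam /= subr0 !mul1r mul0r addr0.
  have [wle|wgt] := leP (width p) (1/2).
    by move=> _; rewrite min_l; [exact: h1|lra].
  have -> : M p = width p by rewrite /M max_l // ltW.
  have wpos : 0 < width p by lra.
  case=> [|KF]; first by lra.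
  by apply: hK => //; apply: scale_in; rewrite ?invr_ge0 // mulVf // gt_eqF.
Qed.

End Box.

Section BoxVR.
Variables (R : realType) (Z : choiceType) (d : Z -> Z -> \bar R).
Variables (X Y : set Z) (r : R).
Hypothesis dP : pseudometric d.
Hypothesis XYT : X `|` Y = setT.
Hypothesis finA : finite_set (X `&` Y).
Hypothesis r_ge0 : 0 <= r.
Hypothesis gluing : metric_gluing d X Y.
Hypothesis ssa : strong_simplex_assumption d r X Y.

Local Notation L := (VR d r setT).
Local Notation K := (VR d r X `|` VR d r Y).

(** The floor lies in |K|, the ceiling is the core of [F], and the walls are the radial segments of
    its collar. Over the collar the floor starts from boundary values of [F], which lie in |K| and
    stay there under the push. *)
Lemma box2 (F : R * R -> geom R L) : continuous F ->
  (forall p, boundaryI2 R p -> K (supp (sval (F p)))) ->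
  exists (S : {fset Z}) (B : R * (R * R) -> geom R L),
  [/\ continuous B, forall p v, v \notin S -> sval (B p) v = 0,
      forall p, unitI2 R p -> B (1, p) = F (scale (1/2) p),
      forall s p, unitI R s -> boundaryI2 R p -> B (s, p) = F (scale (1 - s/2) p) &
      forall p, unitI2 R p -> K (supp (sval (B (0, p))))].
Proof.
move=> cF FK.
have [S [h [hc hS h0 h1 hK]]] := push_into_K dP XYT finA r_ge0 gluing ssa cF.
have [B [[Bc BS B1] [Bb BK]]] := collar_homotopy hc hS h0 h1 hK.
exists S, B; split => // p pI; apply: BK => //.
have [|w] := leP (width p) (1/2); [by left|right].
apply: FK; apply/boundary_width.
by rewrite width_scale ?invr_ge0 ?mulVf ?gt_eqF //; lra.
Qed.

(** A path is treated as a map of the square that ignores the second coordinate, and the box is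
    restricted to the middle line. The midpoint is in the core, so it reaches |K| whatever the ends
    of the path are. *)
Lemma box1 (F : R -> geom R L) : continuous F ->
  exists (S : {fset Z}) (B : R * R -> geom R L),
  [/\ continuous B, forall p v, v \notin S -> sval (B p) v = 0 &
      forall x, unitI R x -> B (1, x) = F (1/4 + x/2)] /\
  [/\ forall s, unitI R s -> B (s, 0) = F (s/4),
      forall s, unitI R s -> B (s, 1) = F (1 - s/4),
      K (supp (sval (B (0, 1/2)))) &
      K (supp (sval (F 0))) -> K (supp (sval (F 1))) ->
      forall x, unitI R x -> K (supp (sval (B (0, x))))].
Proof.
move=> cF; pose F2 (p : R * R) := F p.1.
have cF2 : continuous F2 by apply: (cont_comp _ cF) => p; exact: cvg_fst.
have [S [h [hc hS h0 h1 hK]]] := push_into_K dP XYT finA r_ge0 gluing ssa cF2.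
have [B [[Bc BS B1] [Bb BK]]] := collar_homotopy hc hS h0 h1 hK.
have half : unitI R (1/2) by apply/unitIP; split; lra.
have wE x : width (x, 1/2) = `|2 * x - 1|.
  by rewrite /width /= (_ : 2 * (1/2) - 1 = 0); [rewrite normr0 max_l|field].
exists S, (fun q => B (q.1, (q.2, 1/2))); split; split.
- apply: (cont_comp _ Bc); apply: cont_pair; first by move=> ?; exact: cvg_fst.
  by apply: cont_pair; [move=> ?; exact: cvg_snd|exact: cst_continuous].
- by move=> p v vS; exact: BS.
- by move=> x xI /=; rewrite B1 //; rewrite /F2 /scale /=; congr F; field.
- move=> s sI /=; rewrite Bb //; first by rewrite /F2 /scale /=; congr F; field.
  by split; [split => //; apply/unitIP; split => /=; lra|left].
- move=> s sI /=; rewrite Bb //; first by rewrite /F2 /scale /=; congr F; field.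
  by split; [split => //; apply/unitIP; split => /=; lra|right; left].
- rewrite /=; apply: BK => //; left; rewrite wE (_ : 2 * (1/2) - 1 = 0); last by field.
  by rewrite normr0; lra.
- move=> K0 K1 x xI /=; apply: BK => //.
  have [|w] := leP (width (x, 1/2)) (1/2); [by left|right].
  move: w; rewrite wE /F2 /scale /=.
  by move=> /radial_projection[] ->.
Qed.

End BoxVR.

Lemma geom_incl_inj (R : realType) (Z : choiceType) (K L : set (set Z))
  (KL : K `<=` L) : injective (@geom_incl R Z K L KL).
Proof.
by move=> t t' E; apply: geom_eq => v; rewrite -!(geom_inclE KL) E.
Qed.

(** * Homotopy groups and homotopy fibers *)

Section Conclusions.
Variables (R : realType) (Z : choiceType) (d : Z -> Z -> \bar R).
Variables (X Y : set Z) (r : R).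
Hypothesis dP : pseudometric d.
Hypothesis XYT : X `|` Y = setT.
Hypothesis finA : finite_set (X `&` Y).
Hypothesis r_ge0 : 0 <= r.
Hypothesis gluing : metric_gluing d X Y.
Hypothesis ssa : strong_simplex_assumption d r X Y.

Local Notation L := (VR d r setT).
Local Notation K := (VR d r X `|` VR d r Y).
Local Notation f := (geom_incl (@VR_union_sub R Z d r X Y) : geom R K -> geom R L).

Let fK (x : geom R K) : K (supp (sval (f x))).
Proof. by rewrite geom_inclE; exact: geom_supp. Qed.

Let box1 := box1 dP XYT finA r_ge0 gluing ssa.
Let box2 := box2 dP XYT finA r_ge0 gluing ssa.

Let unit0 : unitI R 0. Proof. by apply/unitIP; split. Qed.
Let unit1 : unitI R 1. Proof. by apply/unitIP; split. Qed.

Lemma lift1 (S : {fset Z}) (B : R * R -> geom R L) : continuous B ->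
  (forall p v, v \notin S -> sval (B p) v = 0) ->
  (forall x, unitI R x -> K (supp (sval (B (0, x))))) ->
  exists2 a : R -> geom R K, continuous a &
    forall x, unitI R x -> f (a x) = B (0, x).
Proof.
move=> cB BS BK; have [|||a ca aE] := @geom_lift R Z K L (@VR_union_sub R Z d r X Y) R S
  (fun x => B (0, clamp x)).
- apply: (cont_comp _ cB); apply: cont_pair; first exact: cst_continuous.
  by apply: continuous_clamp => x; exact: cvg_id.
- by move=> x v; exact: BS.
- by move=> x; apply: BK; exact: clamp_in.
by exists a => // x xI; rewrite aE clamp_id.
Qed.

Lemma lift2 (S : {fset Z}) (B : R * (R * R) -> geom R L) : continuous B ->
  (forall p v, v \notin S -> sval (B p) v = 0) ->
  (forall p, unitI2 R p -> K (supp (sval (B (0, p))))) ->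
  exists2 a : R * R -> geom R K, continuous a &
    forall p, unitI2 R p -> f (a p) = B (0, p).
Proof.
move=> cB BS BK; have [|||a ca aE] := @geom_lift R Z K L (@VR_union_sub R Z d r X Y)
  (R * R)%type S (fun p => B (0, clamp2 p)).
- apply: (cont_comp _ cB); apply: cont_pair; first exact: cst_continuous.
  exact: continuous_clamp2.
- by move=> x v; exact: BS.
- by move=> x; apply: BK; exact: clamp2_in.
by exists a => // x xI; rewrite aE clamp2_id.
Qed.

Lemma clamp_path (U : topologicalType) (g : R -> U) (l : R -> R) :
  {within unitI R, continuous g} -> continuous l ->
  continuous (fun x => g (clamp (l x))).
Proof.
move=> cg cl; apply: (@within_comp _ _ _ (unitI R) (fun x => clamp (l x)) g) => //.
  exact: continuous_clamp.
by move=> x; exact: clamp_in.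
Qed.

Lemma clamp_square (U T : topologicalType) (g : R * R -> U) (l : T -> R * R) :
  {within unitI2 R, continuous g} -> continuous l ->
  continuous (fun x => g (clamp2 (l x))).
Proof.
move=> cg cl; apply: (@within_comp _ _ _ (unitI2 R) (fun x => clamp2 (l x)) g) => //.
  by apply: (cont_comp cl); exact: continuous_clamp2.
by move=> x; exact: clamp2_in.
Qed.

Let affine (a b : R) : continuous (fun x : R => a * x + b).
Proof.
apply: contD; last exact: cst_continuous.
by apply: contM; [exact: cst_continuous|move=> x; exact: cvg_id].
Qed.

(** The constant path at [y] is pushed, and the track of its midpoint joins a point of |K| to
    [y]. *)
Lemma path_to_K (y : geom R L) : exists x, path_connected_pts R (f x) y.
Proof.
have [S [B [[cB BS B1] [_ _ B0 _]]]] := box1 (cst_continuous (x := y)).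
have [|||a ca aE] := @geom_lift R Z K L (@VR_union_sub R Z d r X Y) R S
  (fun=> B (0, 1/2)); [exact: cst_continuous|by move=> ?; exact: BS|by []|].
have half : unitI R (1/2) by apply/unitIP; split; lra.
exists (a 0), (fun s => B (s, 1/2)); split; [|by rewrite aE|by rewrite B1].
apply: continuous_subspaceT; apply: (cont_comp _ cB).
by apply: cont_pair; [move=> ?; exact: cvg_id|exact: cst_continuous].
Qed.

Lemma pi0_bij : pi0_bijective R f.
Proof.
split; first exact: path_to_K.
move=> x x' [g [cg g0 g1]].
have cF : continuous (fun x : R => g (clamp x)).
  by apply: (clamp_path (l := id)) => // ?; exact: cvg_id.
have [S [B [[cB BS B1] [B0l B0r _ B0]]]] := box1 cF.
have [|a ca aE] := lift1 cB BS.
  by apply: B0; rewrite ?clamp_id // ?g0 ?g1; exact: fK.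
exists a; split; first exact: continuous_subspaceT.
- by apply: (@geom_incl_inj _ _ _ _ (@VR_union_sub R Z d r X Y));
    rewrite aE // B0l // mul0r clamp_id.
- by apply: (@geom_incl_inj _ _ _ _ (@VR_union_sub R Z d r X Y));
    rewrite aE // B0r // mul0r subr0 clamp_id.
Qed.

Lemma pi1_isomorphism : pi1_iso R f.
Proof.
move=> x; split.
- move=> g [cg g0 g1].
  (* The loop is run on [1/4, 3/4] and rests at the base point outside. Hence the walls of the box
     are constant and its ceiling is [g]. *)
  have cF : continuous (fun x : R => g (clamp (2 * x + - (1/2)))) by exact: clamp_path.
  have [S [B [[cB BS B1] [B0l B0r _ B0]]]] := box1 cF.
  have F0 (s : R) : s <= 1/4 -> g (clamp (2 * s + - (1/2))) = f x.
    by move=> s0; rewrite clamp_le0 //; lra.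
  have F1 (s : R) : 3/4 <= s -> g (clamp (2 * s + - (1/2))) = f x.
    by move=> s0; rewrite clamp_ge1 //; lra.
  have [|a ca aE] := lift1 cB BS.
    by apply: B0; [rewrite F0|rewrite F1]; [exact: fK|lra|exact: fK|lra].
  exists a.
    split; first exact: continuous_subspaceT.
      apply: (@geom_incl_inj _ _ _ _ (@VR_union_sub R Z d r X Y)).
      by rewrite aE // B0l // F0 //; lra.
    apply: (@geom_incl_inj _ _ _ _ (@VR_union_sub R Z d r X Y)).
    by rewrite aE // B0r // F1 //; lra.
  exists (fun p => B (1 - p.1, p.2)); split.
  + apply: continuous_subspaceT; apply: (cont_comp _ cB); apply: cont_pair.
      by apply: contB; [exact: cst_continuous|move=> ?; exact: cvg_fst].
    by move=> ?; exact: cvg_snd.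
  + move=> s sI /=; rewrite subr0 B1 //.
    have -> : 2 * (1/4 + s/2) + - (1/2) = s by field.
    by rewrite clamp_id.
  + by move=> s sI /=; rewrite subrr aE.
  + move=> u /unitIP[u0 u1] /=; have uI : unitI R (1 - u) by apply/unitIP; split; lra.
    by split; [rewrite B0l // F0 //; lra|rewrite B0r // F1 //; lra].
- move=> h h' [ch h0 h1] [ch' h'0 h'1] [G [cG G0 G1 Gb]].
  have cF : continuous (fun p : R * R => G (clamp2 p)).
    by apply: (clamp_square (l := id)) => // ?; exact: cvg_id.
  have FE (p : R * R) : unitI2 R p -> G (clamp2 p) = G p.
    by move=> pI /=; rewrite clamp2_id.
  (* Only the floor of the box is used: it lies in |K| and agrees with [G] on the boundary of the
     square. *)
  have [|S [B [cB BS _ Bb B0]]] := box2 cF.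
    move=> p pb; have pI := pb.1; rewrite FE //; case: p pb pI => p1 p2.
    move=> [_ /= pb] [/= p1I p2I]; case: pb => [|[|[|]]] E; subst.
    + by rewrite G0 //; exact: fK.
    + by rewrite G1 //; exact: fK.
    + by rewrite (Gb _ p1I).1; exact: fK.
    + by rewrite (Gb _ p1I).2; exact: fK.
  have [a ca aE] := lift2 cB BS B0.
  have ab p : boundaryI2 R p -> f (a p) = G p.
    move=> pb; rewrite aE; last exact: pb.1.
    by rewrite Bb // mul0r subr0 scale1 FE //; exact: pb.1.
  exists a; split; first exact: continuous_subspaceT.
  + move=> s sI; apply: (@geom_incl_inj _ _ _ _ (@VR_union_sub R Z d r X Y)).
    by rewrite ab ?G0 //; split; [split|left].
  + move=> s sI; apply: (@geom_incl_inj _ _ _ _ (@VR_union_sub R Z d r X Y)).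
    by rewrite ab ?G1 //; split; [split|right; left].
  + move=> u uI; have [g0 g1] := Gb u uI.
    split; apply: (@geom_incl_inj _ _ _ _ (@VR_union_sub R Z d r X Y)).
      by rewrite ab ?g0 //; split; [split|right; right; left].
    by rewrite ab ?g1 //; split; [split|right; right; right].
Qed.

Lemma pi2_surjective : pi2_surj R f.
Proof.
move=> x g [cg gb].
(* The sphere is shrunk to the core, and the collar goes to the base point because clamping sends it
   to the boundary. *)
pose F (p : R * R) := g (clamp2 (scale 2 p)).
have cF : continuous F.
  apply: clamp_square => //; apply: scale_continuous; first exact: cst_continuous.
  by move=> ?; exact: cvg_id.
have Fb (l : R) (p : R * R) : boundaryI2 R p -> 1 <= 2 * l -> F (scale l p) = f x.
  move=> pb l1; rewrite /F; apply: gb.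
  by rewrite scaleA; exact: boundary_clamp_scale.
have [|S [B [cB BS B1 Bb B0]]] := box2 cF.
  by move=> p pb; rewrite -(scale1 p) Fb ?mulr1 ?ler1n //; exact: fK.
have [a ca aE] := lift2 cB BS B0.
exists a.
  split; first exact: continuous_subspaceT.
  move=> p pb; apply: (@geom_incl_inj _ _ _ _ (@VR_union_sub R Z d r X Y)).
  by rewrite aE ?Bb //; [rewrite Fb //; lra|exact: pb.1].
exists (fun q => B (1 - q.1, q.2)); split.
- apply: continuous_subspaceT; apply: (cont_comp _ cB); apply: cont_pair.
    by apply: contB; [exact: cst_continuous|move=> ?; exact: cvg_fst].
  by move=> ?; exact: cvg_snd.
- move=> p pI /=; rewrite subr0 B1 // /F.
  by rewrite scaleA mul1r divff ?pnatr_eq0 // scale1 clamp2_id.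
- by move=> p pI /=; rewrite subrr aE.
- move=> u p /unitIP[u0 u1] pb /=; have uI : unitI R (1 - u) by apply/unitIP; split; lra.
  by rewrite Bb // Fb //; lra.
Qed.

Lemma hofiber_connected (y : geom R L) x0 (c0 : R -> geom R L) x1 (c1 : R -> geom R L) :
  hofiber_pt f y x0 c0 -> hofiber_pt f y x1 c1 ->
  exists a G, hofiber_path f y x0 c0 x1 c1 a G.
Proof.
move=> [cc0 c00 c01] [cc1 c10 c11].
(* This path follows [c0] on the first quarter, rests at [y], and returns along [c1] on the last
   quarter. The walls of its box are [c0] and [c1] and its ceiling is [y], which is a path in the
   fiber. *)
pose F (x : R) := if x - 1/2 <= 0 then c0 (clamp (4 * x + 0)) else c1 (clamp (- 4 * x + 4)).
have cF : continuous F.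
  apply: cont_if; [|exact: clamp_path|exact: clamp_path|].
    by apply: contB; [move=> ?; exact: cvg_id|exact: cst_continuous].
  move=> x x0E; have -> : x = 1/2 by lra.
  by rewrite !clamp_ge1 ?c01 ?c11 //; lra.
have [S [B [[cB BS B1] [B0l B0r _ B0]]]] := box1 cF.
have Fl s : unitI R s -> F (s / 4) = c0 s.
  move=> sI; have /unitIP[s0 s1] := sI; rewrite /F ifT; last lra.
  by have -> : 4 * (s/4) + 0 = s; [field|rewrite clamp_id].
have Fr s : unitI R s -> F (1 - s / 4) = c1 s.
  move=> sI; have /unitIP[s0 s1] := sI; rewrite /F ifF; last by apply/negP/negP; rewrite -ltNge; lra.
  by have -> : - 4 * (1 - s/4) + 4 = s; [field|rewrite clamp_id].
have F0 : F 0 = f x0 by rewrite -(mul0r 4^-1) Fl.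
have F1 : F 1 = f x1 by rewrite -[1]subr0 -(mul0r 4^-1) Fr.
have [|a ca aE] := lift1 cB BS; first by apply: B0; rewrite ?F0 ?F1; exact: fK.
exists a, (fun p => B (p.2, p.1)); split.
- split; first exact: continuous_subspaceT.
    apply: (@geom_incl_inj _ _ _ _ (@VR_union_sub R Z d r X Y)).
    by rewrite aE // B0l // mul0r.
  apply: (@geom_incl_inj _ _ _ _ (@VR_union_sub R Z d r X Y)).
  by rewrite aE // B0r // mul0r subr0.
- apply: continuous_subspaceT; apply: (cont_comp _ cB); apply: cont_pair.
    by move=> ?; exact: cvg_snd.
  by move=> ?; exact: cvg_fst.
- by move=> s sI /=; rewrite B0l // B0r // Fl // Fr.
- move=> t tI /=; split; first by rewrite aE.
  have /unitIP[t0 t1] := tI; rewrite B1 // /F; case: ifP => _.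
    by rewrite clamp_ge1 //; lra.
  by rewrite clamp_ge1 //; lra.
Qed.

Lemma hofiber_loop (y : geom R L) x0 (c0 : R -> geom R L) (a : R -> geom R K)
  (G : R * R -> geom R L) :
  hofiber_pt f y x0 c0 -> hofiber_path f y x0 c0 x0 c0 a G ->
  exists (A : R * R -> geom R K) (B : R * (R * R) -> geom R L),
       [/\ {within unitI2 R, continuous A}, {within unitI3 R, continuous B},
           (forall t, unitI R t -> A (0, t) = a t /\ A (1, t) = x0) &
           (forall u, unitI R u -> A (u, 0) = x0 /\ A (u, 1) = x0)] /\
       [/\ (forall t s, unitI R t -> unitI R s ->
              B (0, (t, s)) = G (t, s) /\ B (1, (t, s)) = c0 s),
           (forall u s, unitI R u -> unitI R s ->
              B (u, (0, s)) = c0 s /\ B (u, (1, s)) = c0 s) &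
           (forall u t, unitI R u -> unitI R t ->
              B (u, (t, 0)) = f (A (u, t)) /\ B (u, (t, 1)) = y)].
Proof.
move=> [cc0 c00 c01] [[ca a0 a1] cG Gs Gt].
pose M (q : R * R) := Num.max (width q) (1/2).
pose sg (q : R * R) := 2 * (1 - width q).
pose b (q : R * R) := 1/2 + (q.2 - 1/2) / M q.
(* The core is [y]. In the collar [sg] is the depth, from 0 on the boundary to 1 at the core, and
   [b] is the projected second coordinate. The left half carries [G], the right half [c0], so the
   left wall of the box becomes [G] and the other three [c0]. *)
pose F (q : R * R) := if q.1 - 1/2 <= 0 then G (clamp2 (b q, sg q)) else c0 (clamp (sg q)).
have cw := @width_continuous R.
have M0 q : 0 < M q by rewrite /M lt_max; apply/orP; right; lra.
have csg : continuous sg.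
  apply: contM; first exact: cst_continuous.
  by apply: contB => //; exact: cst_continuous.
have cb : continuous b.
  apply: contD; first exact: cst_continuous.
  apply: contM; first by apply: contB; [move=> ?; exact: cvg_snd|exact: cst_continuous].
  apply: contV; last by move=> q; rewrite gt_eqF.
  by apply: cont_max => //; exact: cst_continuous.
have core (q : R * R) : width q <= 1/2 -> F q = y.
  move=> wq; have s1 : clamp (sg q) = 1 by apply: clamp_ge1; rewrite /sg; lra.
  rewrite /F /clamp2 /= s1 c01; case: ifP => // _.
  by have [] := Gt _ (clamp_in (b q)).
have cF : continuous F.
  apply: cont_if.
  - by apply: contB; [move=> ?; exact: cvg_fst|exact: cst_continuous].
  - by apply: clamp_square => //; apply: cont_pair.
  - apply: (@within_comp _ _ _ (unitI R) (fun q => clamp (sg q)) c0) => //.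
      exact: continuous_clamp.
    by move=> q; exact: clamp_in.
  (* On the line where the halves meet, both give [y] in the core; in the collar [b] is an end of
     the interval, where [G] equals [c0]. *)
  - move=> q q1; have [wq|wq] := leP (width q) (1/2).
      have s1 : clamp (sg q) = 1 by apply: clamp_ge1; rewrite /sg; lra.
      rewrite /clamp2 /= s1 c01.
      by have [] := Gt _ (clamp_in (b q)).
    have Mq : M q = width q by rewrite /M max_l // ltW.
    have wE : width q = `|2 * q.2 - 1|.
      have E : q.1 = 1/2 by lra.
      by rewrite /width (_ : 2 * q.1 - 1 = 0); [rewrite normr0 max_r|rewrite E; field].
    have sI := clamp_in (sg q); have [G0 G1] := Gs _ sI.
    rewrite /clamp2 /=; suff : clamp (b q) = 0 \/ clamp (b q) = 1 by case=> ->.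
    rewrite /b Mq; move: wq; rewrite wE.
    by move=> /radial_projection[] ->; [left; apply: clamp_le0|right; apply: clamp_ge1].
have FbE s (p : R * R) : unitI R s -> boundaryI2 R p ->
    F (scale (1 - s/2) p) = if p.1 - 1/2 <= 0 then G (p.2, s) else c0 s.
  move=> sI pb; have /unitIP[s0 s1] := sI; have wp : width p = 1 by apply/boundary_width.
  have l0 : 0 < 1 - s/2 by lra.
  have wE : width (scale (1 - s/2) p) = 1 - s/2 by rewrite width_scale ?wp ?mulr1 // ltW.
  have sE : sg (scale (1 - s/2) p) = s by rewrite /sg wE; field.
  have bE : b (scale (1 - s/2) p) = p.2.
    rewrite /b /M wE max_l; last lra.
    by rewrite /scale /= addrAC subrr add0r mulfK ?gt_eqF // addrC subrK.
  rewrite /F sE bE /scale /=.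
  have -> : (1/2 + (p.1 - 1/2) * (1 - s/2) - 1/2 <= 0) = (p.1 - 1/2 <= 0).
    have -> : 1/2 + (p.1 - 1/2) * (1 - s/2) - 1/2 = (p.1 - 1/2) * (1 - s/2) by ring.
    by rewrite pmulr_lle0.
  have [[_ p2I] _] := pb.
  by rewrite /clamp2 /= !clamp_id.
have sc1 (p : R * R) : scale (1 - 0/2) p = p.
  by rewrite mul0r subr0 scale1.
have [|S [B [cB BS B1 Bb B0]]] := box2 cF.
  move=> p pb; rewrite -(sc1 p) FbE //; case: ifP => _; last by rewrite c00; exact: fK.
  by have [[_ p2I] _] := pb; rewrite (Gt _ p2I).1; exact: fK.
have [A cA AE] := lift2 cB BS B0.
have bl t : unitI R t -> boundaryI2 R (0, t) by move=> tI; split; [split|left].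
have br t : unitI R t -> boundaryI2 R (1, t) by move=> tI; split; [split|right; left].
have bd u : unitI R u -> boundaryI2 R (u, 0) by move=> uI; split; [split|right; right; left].
have bu u : unitI R u -> boundaryI2 R (u, 1) by move=> uI; split; [split|right; right; right].
have Bl s t : unitI R s -> unitI R t -> B (s, (0, t)) = G (t, s).
  move=> sI tI; rewrite Bb //; last exact: bl.
  by rewrite FbE //; [rewrite /= ifT //; lra|exact: bl].
have Br s t : unitI R s -> unitI R t -> B (s, (1, t)) = c0 s.
  move=> sI tI; rewrite Bb //; last exact: br.
  rewrite FbE //; last exact: br.
  by rewrite /= ifF //; apply/negP/negP; rewrite -ltNge; lra.
have Bd s u : unitI R s -> unitI R u -> B (s, (u, 0)) = c0 s.
  move=> sI uI; rewrite Bb //; last exact: bd.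
  rewrite FbE //=; last exact: bd.
  by case: ifP => // _; case: (Gs _ sI).
have Bu s u : unitI R s -> unitI R u -> B (s, (u, 1)) = c0 s.
  move=> sI uI; rewrite Bb //; last exact: bu.
  rewrite FbE //=; last exact: bu.
  by case: ifP => // _; case: (Gs _ sI).
have inj := @geom_incl_inj R Z _ _ (@VR_union_sub R Z d r X Y).
(* The height of the box becomes the parameter of the paths in the fiber, and the first coordinate
   of the square becomes the parameter of the null-homotopy. *)
exists A, (fun q => B (q.2.2, (q.1, q.2.1))); split; split.
- exact: continuous_subspaceT.
- apply: continuous_subspaceT; apply: (cont_comp _ cB).
  apply: cont_pair; first by apply: cont_snd => ?; exact: cvg_snd.
  apply: cont_pair; first by move=> ?; exact: cvg_fst.
  by apply: cont_fst => ?; exact: cvg_snd.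
- move=> t tI; split; apply: inj; rewrite AE //.
    by rewrite Bl // (Gt _ tI).1.
  by rewrite Br.
- by move=> u uI; split; apply: inj; rewrite AE // ?Bd ?Bu.
- by move=> t s tI sI /=; rewrite Bl ?Br.
- by move=> u s uI sI /=; rewrite Bd ?Bu.
- move=> u t uI tI /=; rewrite AE //; split => //.
  rewrite B1 //; apply: core; rewrite width_scale; last lra.
  have : width (u, t) <= 1 by apply/width_le1.
  lra.
Qed.

End Conclusions.

Unset Implicit Arguments.

Theorem theorem11p5 (R : realType) (Z : choiceType) (d : Z -> Z -> \bar R)
  (X Y : set Z) (r : R) :
  pseudometric d ->
  X `|` Y = setT ->
  finite_set (X `&` Y) ->
  0 <= r ->
  metric_gluing d X Y ->
  strong_simplex_assumption d r X Y ->
  (forall s, VR d r setT s -> ~ Pgood d r X Y s ->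
     (exists x, s `&` X = [set x]) \/ (exists y, s `&` Y = [set y]) ->
     contractible R (geom R (St (VR d r setT) s (X `&` Y)))) /\
  (let f := geom_incl (@VR_union_sub R Z d r X Y) :
              geom R (VR d r X `|` VR d r Y) -> geom R (VR d r setT) in
   [/\ forall y, hofiber_simply_connected R f y,
       pi0_bijective R f,
       pi1_iso R f &
       pi2_surj R f]).
Proof.
move=> dP XYT finA r_ge0 gluing ssa; split.
  by move=> s Ls bs os; exact: contractible_St.
split.
- move=> y; split; last split.
  + by have [x [c cP]] := path_to_K dP XYT finA r_ge0 gluing ssa y; exists x, c.
  + exact: hofiber_connected.
  + exact: hofiber_loop.
- exact: pi0_bij.
- exact: pi1_isomorphism.
- exact: pi2_surjective.
Qed.
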